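(* Let $X$ be a finite connected (polygonal) 2-complex whose fundamental group $\Gamma$ has property $(\tau)$. Let $\Gamma_i\unlhd\Gamma$ be a residual chain and let $X_i=\widetilde X/\Gamma_i$ be the corresponding covers of $X$. If there is a constant $C>0$ such that $$[\Gamma:\Gamma_i]\le C\,\xi_2(X_i;\mathbb{Z})\,\rho_1(X_i;\mathbb{Z})\quad\text{for all } i,$$ then $$0<\liminf_{i\to\infty}\frac{\log\#\Gamma_i^{ab}}{[\Gamma:\Gamma_i]}.$$
   Context: A (polygonal) 2-complex is a cell complex of dimension 2 whose 2-cells are regular polygons with every boundary edge of length $1$, attached along edge loops. Covers carry the lifted cell structure; $\widetilde X$ is the universal cover. $\Gamma_i^{ab}$ is the abelianization of $\Gamma_i$ and $\#$ denotes cardinality. Property $(\tau)$ is meant with respect to all finite index normal subgroups: for a finite generating set $S$ of $\Gamma$ the Cayley graphs of the quotients $\Gamma/N$ with respect to the image of $S$, $N$ ranging over all finite index normal subgroups, form a family of expanders (uniform spectral gap). In this case every finite index normal subgroup has finite abelianization. A residual chain is a nested sequence $\Gamma\ge\Gamma_1\ge\Gamma_2\ge\cdots$ of finite index normal subgroups of $\Gamma$ with $\bigcap_i\Gamma_i=\{1\}$ and $[\Gamma:\Gamma_i]\to\infty$. For a finite 2-complex $X$, the cellular chain groups $C_p(X;\mathbb{Z})$ carry the $\ell^1$ norm with respect to the basis of $p$-cells: $\|\sum a_i\sigma_i\|=\sum|a_i|$. For an exact 1-cycle $z\in\partial C_2(X;\mathbb{Z})$ set $\mathsf{fill}_1(z;\mathbb{Z})=\inf\{\|A\|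 : A\in C_2(X;\mathbb{Z}),\ \partial A=z\}$. Define $$\rho_1(X;\mathbb{Z})=\inf_{0\ne z\in\partial C_2(X;\mathbb{Z})}\frac{\|z\|}{\mathsf{fill}_1(z;\mathbb{Z})}.$$ Since $X$ is a 2-complex, $H_2(X;\mathbb{Z})$ is identified with the group of 2-cycles $\ker(\partial_2)\subset C_2(X;\mathbb{Z})$. If $H_2(X;\mathbb{Z})$ has rank $b>0$, $$\xi_2(X;\mathbb{Z})=\inf\Bigl\{\max_{1\le j\le b}\|S_j\| : S_1,\dots,S_b\in H_2(X;\mathbb{Z})\text{ generate a rank } b\text{ subgroup of }H_2(X;\mathbb{Z})\Bigr\},$$ and $\xi_2(X;\mathbb{Z})=0$ if $H_2(X;\mathbb{Z})=0$. *)

(* Defs.v *)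
From HB Require Import structures.
From Stdlib Require Export Relation_Operators.
From mathcomp Require Export all_boot all_order all_algebra.
From mathcomp Require Export finmap.
From mathcomp Require Export all_classical all_reals all_analysis.
From mathcomp.multinomials Require Export freeg.
Export numFieldNormedType.Exports.

Set Implicit Arguments.
Unset Strict Implicit.
Unset Printing Implicit Defensive.

Import Order.TTheory GRing.Theory Num.Theory.

Local Open Scope quotient_scope.
Local Open Scope classical_set_scope.
Local Open Scope ring_scope.

Section Groups.
Variable G : groupType.
Implicit Types (A H N : set G).

Definition subgroup H :=
  [/\ H 1%g, forall x y, H x -> H y -> H (x * y)%g
    & forall x, H x -> H (x^-1)%g].

Definition normal_subgroup N :=
  subgroup N /\ forall g x, N x -> N (x ^ g)%g.

Definition lcoset (g : G) H : set G := [set (g * h)%g | h in H].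

Definition lcosets A H : set (set G) := [set lcoset g H | g in A].

(* For A a subgroup containing H this is [A : H] when that index is finite,
   and the junk value 0 when it is infinite. *)
Definition gindex A H : nat := #|` fset_set (lcosets A H)|.

Definition finite_index H := finite_set (lcosets [set: G] H).

Definition generated A : set G :=
  [set x | forall H, subgroup H -> A `<=` H -> H x].

Definition derived H : set G :=
  generated [set ([~ x, y])%g | x in H & y in H].

(* The cardinality of H^ab = H / [H, H]; 0 if H^ab is infinite. *)
Definition card_ab H : nat := gindex H (derived H).

Variable R : realType.

(* The Laplacian of the Cayley graph of G / N with respect to the image of S,
   for N normal. The vertices of the graph are the cosets gN; each s in S joins
   gN to gsN, edges being counted with multiplicity, so that every vertex has
   degree 2 (size S). *)
Definition cayley_laplacian (S : seq G) (f : set G -> R) (A : set G) : R :=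
  \sum_(s <- S) ((f A - f [set (a * s)%g | a in A]) +
                 (f A - f [set (a * s^-1)%g | a in A])).

(* All eigenvalues of the Laplacian on the functions of mean zero are at least
   eps: as 0 is an eigenvalue with the constants as eigenfunctions, this says
   that the second smallest eigenvalue is at least eps. *)
Definition spectral_gap_ge (S : seq G) N (eps : R) :=
  forall (lam : R) (f : set G -> R),
    (exists2 A, lcosets [set: G] N A & f A != 0) ->
    \sum_(A <- fset_set (lcosets [set: G] N)) f A = 0 ->
    (forall A, lcosets [set: G] N A -> cayley_laplacian S f A = lam * f A) ->
    eps <= lam.

(* Uniform over all finite index normal subgroups. For a finitely generated
   group the choice of the finite generating set S does not matter. *)
Definition property_tau :=
  exists2 S : seq G, generated [set` S] = [set: G] &
  exists2 eps : R, 0 < eps &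
    forall N, normal_subgroup N -> finite_index N -> spectral_gap_ge S N eps.

Definition residual_chain (N : nat -> set G) :=
  [/\ forall i, normal_subgroup (N i) /\ finite_index (N i),
      forall i, N i.+1 `<=` N i,
      \bigcap_i N i = [set 1%g]
    & gindex [set: G] (N i) @[i --> \oo] --> \oo].

End Groups.

Record graph := Graph {
  vert : choiceType;
  edge : choiceType;
  src : edge -> vert;
  tgt : edge -> vert }.

(* An edge together with a direction of travel, true being src to tgt. *)
Definition dart (X : graph) := (edge X * bool)%type.

Section Walks.
Variable X : graph.
Implicit Types (d : dart X) (p q : seq (dart X)) (x : vert X).

Definition dsrc d := if d.2 then src d.1 else tgt d.1.
Definition dtgt d := if d.2 then tgt d.1 else src d.1.
Definition dinv d : dart X := (d.1, ~~ d.2).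
Definition pinv p := rev (map dinv p).

Fixpoint walk x p :=
  if p is d :: p' then (dsrc d == x) && walk (dtgt d) p' else true.

Definition wend x p := last x (map dtgt p).

Lemma walk_cat x p q : walk x (p ++ q) = walk x p && walk (wend x p) q.
Proof. by elim: p x => //= d p IH x; rewrite IH andbA. Qed.

Lemma wend_cat x p q : wend x (p ++ q) = wend (wend x p) q.
Proof. by rewrite /wend map_cat last_cat. Qed.

Lemma dsrc_inv d : dsrc (dinv d) = dtgt d. Proof. by case: d => e []. Qed.
Lemma dtgt_inv d : dtgt (dinv d) = dsrc d. Proof. by case: d => e []. Qed.
Lemma dinvK : involutive dinv. Proof. by case=> e []. Qed.

Lemma pinvK : involutive pinv.
Proof. by move=> p; rewrite /pinv map_rev revK (mapK dinvK). Qed.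

Lemma pinv_cons d p : pinv (d :: p) = pinv p ++ [:: dinv d].
Proof. by rewrite /pinv /= rev_cons cats1. Qed.

Lemma walk_pinv x p : walk x p ->
  walk (wend x p) (pinv p) /\ wend (wend x p) (pinv p) = x.
Proof.
elim: p x => [|d p IH] x //= /andP[/eqP dx /IH[wp ep]].
rewrite pinv_cons walk_cat wend_cat -/(wend _ _).
by rewrite /wend /= -/(wend _ _) in wp ep *; rewrite wp ep /= dsrc_inv dtgt_inv eqxx.
Qed.

End Walks.

(* A 2-cell f is an n-gon attached along an edge loop of length
   n = size (bdry f) > 0, read from the vertex base f. *)
Record complex2 := Complex2 {
  skel :> graph;
  face : choiceType;
  base : face -> vert skel;
  bdry : face -> seq (dart skel);
  bdry_neq0 : forall f, bdry f != [::];
  bdry_walk : forall f, walk (base f) (bdry f);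
  bdry_loop : forall f, wend (base f) (bdry f) = base f }.

Definition finite_complex (X : complex2) :=
  [/\ finite_set [set: vert X], finite_set [set: edge X]
    & finite_set [set: face X]].

Definition connected_complex (X : complex2) :=
  forall x y : vert X, exists2 p, walk x p & wend x p = y.

Section Homotopy.
Variables (X : complex2) (x0 : vert X).

Definition epath := {p : seq (dart X) | walk x0 p}.
Implicit Types (u v w : epath) (p q : seq (dart X)).

Definition pend u := wend x0 (val u).

Inductive elementary : seq (dart X) -> seq (dart X) -> Prop :=
| Backtrack p d q : elementary (p ++ d :: dinv d :: q) (p ++ q)
| Cell p f q : elementary (p ++ bdry f ++ q) (p ++ q).

(* Homotopy relative to the endpoints. *)
Definition homotopic : epath -> epath -> Prop :=
  clos_refl_sym_trans epath (fun u v => elementary (val u) (val v)).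

Definition homotopicb u v := `[< homotopic u v >].

Lemma homotopic_refl : reflexive homotopicb.
Proof. by move=> u; apply/asboolP/rst_refl. Qed.
Lemma homotopic_sym : symmetric homotopicb.
Proof. by move=> u v; apply/asboolP/asboolP => H; apply: rst_sym. Qed.
Lemma homotopic_trans : transitive homotopicb.
Proof. by move=> v u w /asboolP uv /asboolP vw; apply/asboolP/rst_trans/vw. Qed.

Canonical homotopic_equiv :=
  EquivRel homotopicb homotopic_refl homotopic_sym homotopic_trans.

(* This is also the vertex set of the universal cover. *)
Definition pclass := {eq_quot homotopicb}.
HB.instance Definition _ := Choice.on pclass.
HB.instance Definition _ := EqQuotient.on pclass.

Definition pi_ (u : epath) : pclass := \pi_pclass u.

Lemma pi_P u v : homotopic u v <-> pi_ u = pi_ v.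
Proof.
split=> [H|/eqquotP/asboolP//].
by apply/eqquotP/asboolP.
Qed.

Lemma pi_repr (c : pclass) : pi_ (repr c) = c. Proof. exact: reprK. Qed.

Lemma wend_elementary x p q : elementary p q -> walk x p -> walk x q ->
  wend x p = wend x q.
Proof.
case=> {p q} [p d q|p f q].
  rewrite walk_cat /= => /and4P[_ /eqP dp _ _] _.
  rewrite !wend_cat -[wend _ (d :: _)]/(wend (dtgt (dinv d)) q).
  by rewrite dtgt_inv dp.
rewrite !walk_cat => /and3P[_ wb _] _; rewrite !wend_cat.
suff -> : wend x p = base f by rewrite bdry_loop.
have := bdry_walk f; have := bdry_neq0 f.
by case: (bdry f) wb => //= d b /andP[/eqP-> _] _ /andP[/eqP].
Qed.

Lemma pend_homotopic u v : homotopic u v -> pend u = pend v.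
Proof.
elim=> {u v} [u v /wend_elementary uv|u|u v _ ->|u w v _ -> _ ->] //.
exact: uv (valP u) (valP v).
Qed.

(* The endpoint of the paths in c. *)
Definition cend (c : pclass) : vert X := pend (repr c).

Lemma cend_pi u : cend (pi_ u) = pend u.
Proof. by apply/pend_homotopic/pi_P; rewrite pi_repr. Qed.

(* Concatenation. It is only used when p starts at the endpoint of u, and has
   the junk value u otherwise. *)
Definition pcat u p : epath := insubd u (val u ++ p).

Lemma val_pcat u p : walk (pend u) p -> val (pcat u p) = val u ++ p.
Proof. by move=> w; rewrite insubdK// -topredE /= walk_cat (valP u). Qed.

Lemma pcat_junk u p : ~~ walk (pend u) p -> pcat u p = u.
Proof.
move=> w; rewrite /pcat /insubd insubN//.
by rewrite walk_cat (valP u).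
Qed.

Lemma elementary_catr p q r : elementary p q -> elementary (p ++ r) (q ++ r).
Proof.
by case=> {p q} [p d q|p f q]; rewrite -!catA; [exact: Backtrack|exact: Cell].
Qed.

Lemma elementary_catl p q r : elementary p q -> elementary (r ++ p) (r ++ q).
Proof.
by case=> {p q} [p d q|p f q]; rewrite !(catA r); [exact: Backtrack|exact: Cell].
Qed.

Lemma homotopic_pcatr u v p : homotopic u v -> homotopic (pcat u p) (pcat v p).
Proof.
elim=> {u v} [u v uv|u|u v _|u w v _ uw _]; last exact: rst_trans.
- have euv : pend u = pend v by apply: pend_homotopic; exact: rst_step.
  have [wp|wp] := boolP (walk (pend u) p).
    apply: rst_step; rewrite !val_pcat -?euv//.
    exact: elementary_catr.
  by rewrite !pcat_junk -?euv//; exact: rst_step.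
- exact: rst_refl.
- exact: rst_sym.
Qed.

Lemma homotopic_pcatl u v w : pend u = x0 -> homotopic v w ->
  homotopic (pcat u (val v)) (pcat u (val w)).
Proof.
move=> eu; elim=> {v w} [v w vw|v|v w _|v z w _ vz _]; last exact: rst_trans.
- apply: rst_step; rewrite !val_pcat ?eu ?(valP v) ?(valP w)//.
  exact: elementary_catl.
- exact: rst_refl.
- exact: rst_sym.
Qed.

(* The class c followed by the path p, meant for p starting at cend c. *)
Definition ext (c : pclass) p : pclass := pi_ (pcat (repr c) p).

Lemma ext_pi u p : ext (pi_ u) p = pi_ (pcat u p).
Proof. by apply/pi_P/homotopic_pcatr/pi_P; rewrite pi_repr. Qed.

Lemma cend_ext c p : walk (cend c) p -> cend (ext c p) = wend (cend c) p.
Proof. by move=> w; rewrite cend_pi /pend val_pcat// wend_cat. Qed.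

Lemma ext_nil c : ext c [::] = c.
Proof.
rewrite -[RHS]pi_repr; congr pi_; apply: val_inj.
by rewrite val_pcat// cats0.
Qed.

Lemma ext_cat c p q : walk (cend c) (p ++ q) ->
  ext c (p ++ q) = ext (ext c p) q.
Proof.
rewrite walk_cat => /andP[wp wq]; rewrite ext_pi; congr pi_; apply: val_inj.
rewrite !val_pcat ?catA ?walk_cat ?wp//.
by rewrite /pend val_pcat// wend_cat.
Qed.

Lemma ext_elementary c p q : elementary p q -> walk (cend c) p ->
  walk (cend c) q -> ext c p = ext c q.
Proof.
move=> pq wp wq; apply/pi_P/rst_step; rewrite !val_pcat//.
exact: elementary_catl.
Qed.

Lemma ext_pinv c p : walk (cend c) p -> ext (ext c p) (pinv p) = c.
Proof.
elim: p c => [|d p IH] c /=; first by rewrite !ext_nil.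
move=> /andP[/eqP dc wp].
have cd : cend (ext c [:: d]) = dtgt d by rewrite cend_ext //= dc eqxx.
rewrite -cat1s ext_cat /= ?dc ?eqxx// pinv_cons ext_cat; last first.
  have w : walk (cend (ext c [:: d])) p by rewrite cd.
  have [w1 w2] := walk_pinv w.
  by rewrite cend_ext// walk_cat w1 w2 /= cd dsrc_inv eqxx.
rewrite IH ?cd// -ext_cat /= ?dc ?dsrc_inv ?eqxx//.
rewrite -[RHS]ext_nil; apply: ext_elementary => //.
  exact: (@Backtrack [::] d [::]).
by rewrite /= dc dsrc_inv !eqxx.
Qed.

Lemma ext_bdry c f : cend c = base f -> ext c (bdry f) = c.
Proof.
move=> cf; rewrite -[RHS]ext_nil; apply: ext_elementary => //.
  by have := @Cell [::] f [::]; rewrite /= cats0.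
by rewrite cf bdry_walk.
Qed.

Definition nilpath : epath := exist (fun p => walk x0 p) [::] isT.

(* The fundamental group: the classes of closed paths at x0. *)
Record pi1 := Pi1 { loopc :> pclass; loopP : cend loopc == x0 }.

HB.instance Definition _ := [isSub for loopc].
HB.instance Definition _ := [Choice of pi1 by <:].

Implicit Types (g h k : pi1) (c : pclass).

Lemma pendg g : cend g = x0. Proof. exact/eqP/loopP. Qed.

(* The action of pi1 on the classes of paths from x0: loop first. *)
Definition act g c : pclass := ext g (val (repr c)).

Lemma walkg g c : walk (cend g) (val (repr c)).
Proof. by rewrite pendg; exact: valP. Qed.

Lemma cend_act g c : cend (act g c) = cend c.
Proof. by rewrite cend_ext ?walkg// pendg. Qed.

Lemma act_pi g u : act g (pi_ u) = ext g (val u).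
Proof. by apply/pi_P/homotopic_pcatl; [exact: pendg|apply/pi_P; rewrite pi_repr]. Qed.

Lemma act_ext g c p : walk (cend c) p -> act g (ext c p) = ext (act g c) p.
Proof.
move=> wp; rewrite {1}/ext act_pi val_pcat// ext_cat//.
by rewrite walk_cat walkg pendg.
Qed.

Lemma mul_proof g h : cend (act g h) == x0. Proof. by rewrite cend_act pendg. Qed.
Definition pi1_mul g h := Pi1 (mul_proof g h).

Lemma one_proof : cend (pi_ nilpath) == x0. Proof. by rewrite cend_pi. Qed.
Definition pi1_one := Pi1 one_proof.

Lemma inv_walk g : walk x0 (pinv (val (repr (g : pclass)))).
Proof. by have [] := walk_pinv (valP (repr (g : pclass))); rewrite -/(pend _) -/(cend _) pendg. Qed.

Definition inv_path g : epath := exist (fun p => walk x0 p) _ (inv_walk g).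

Lemma inv_proof g : cend (pi_ (inv_path g)) == x0.
Proof.
rewrite cend_pi /pend /=; apply/eqP.
by have [_] := walk_pinv (valP (repr (g : pclass))); rewrite -/(pend _) -/(cend _) pendg.
Qed.
Definition pi1_inv g := Pi1 (inv_proof g).

Lemma ext_one u : ext pi1_one (val u) = pi_ u.
Proof.
rewrite /= ext_pi; congr pi_; apply: val_inj.
by rewrite val_pcat//; exact: (valP u).
Qed.

Lemma act1 c : act pi1_one c = c.
Proof. by rewrite /act ext_one pi_repr. Qed.

Lemma actM g h c : act (pi1_mul g h) c = act g (act h c).
Proof. by rewrite [act h c]/act act_ext ?walkg. Qed.

Lemma pi1_mulA : associative pi1_mul.
Proof. by move=> g h k; apply: val_inj; rewrite /= actM. Qed.

Lemma pi1_mul1g : left_id pi1_one pi1_mul.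
Proof. by move=> g; apply: val_inj; rewrite /= act1. Qed.

Lemma pi1_mulg1 : right_id pi1_one pi1_mul.
Proof. by move=> g; apply: val_inj; rewrite /= act_pi ext_nil. Qed.

Lemma pi1_mulgV : right_inverse pi1_one pi1_inv pi1_mul.
Proof.
move=> g; apply: val_inj; rewrite /= act_pi /=.
have e : ext pi1_one (val (repr (g : pclass))) = g by rewrite ext_one pi_repr.
by rewrite -[X in ext X _]e ext_pinv// pendg; exact: valP.
Qed.

Lemma pi1_mulVg : left_inverse pi1_one pi1_inv pi1_mul.
Proof.
move=> g; apply: val_inj; rewrite /= /act /=.
rewrite -[X in ext X _](ext_one (inv_path g)) /=.
have := @ext_pinv (pi_ nilpath) (pinv (val (repr (g : pclass)))).
rewrite pinvK; apply.
rewrite cend_pi; exact: inv_walk.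
Qed.

HB.instance Definition _ := isGroup.Build pi1
  pi1_mulA pi1_mul1g pi1_mulg1 pi1_mulVg pi1_mulgV.

End Homotopy.

Section UniversalCover.
Variables (X : complex2) (x0 : vert X).
Local Notation pclass := (pclass x0).
Implicit Types (c : pclass) (d : dart X) (p : seq (dart X)).

(* The cells of the universal cover over the cells k : K of X, whose
   attaching data start at the vertex h k: the pairs of a vertex c of the
   universal cover over h k and of k. *)
Definition ulift (K : choiceType) (h : K -> vert X) :=
  {ck : (pclass * K)%type | cend ck.1 == h ck.2}.

Definition uedge := ulift (@src X).
Definition uface := ulift (@base X).

Definition usrc (e : uedge) : pclass := (val e).1.
Definition utgt (e : uedge) : pclass := ext (val e).1 [:: ((val e).2, true)].

Definition ugraph := @Graph pclass uedge usrc utgt.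

Definition uproj (d : dart ugraph) : dart X := ((val d.1).2, d.2).

(* The dart of the universal cover over d that starts at c; it exists as soon
   as d starts at the endpoint of c (lemma udartP). *)
Definition udart c d : option (dart ugraph) :=
  omap (fun e : uedge => (e, d.2))
    (insub (if d.2 then c else ext c [:: d], d.1)).

(* The lift from c of the path p, meant for p starting at cend c. *)
Fixpoint ulift_path c p : seq (dart ugraph) :=
  if p is d :: p' then
    oapp cons id (udart c d) (ulift_path (ext c [:: d]) p')
  else [::].

Lemma udartP c d : dsrc d = cend c ->
  exists2 u, udart c d = Some u &
    [/\ uproj u = d, dsrc u = c & dtgt u = ext c [:: d]].
Proof.
case: d => e [] /= dc; rewrite /udart /=.
  case: (insubP uedge (c, e)) => [u _ uE|]; last by rewrite /= -dc eqxx.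
  by exists (u, true) => //; rewrite /uproj /dsrc /dtgt /= /usrc /utgt !uE.
case: (insubP uedge (ext c [:: (e, false)], e)) => [u _ uE|]; last first.
  by rewrite /= cend_ext /= ?eqxx// -dc eqxx.
exists (u, false) => //; rewrite /uproj /dsrc /dtgt /= /usrc /utgt !uE.
by split=> //=; apply: (@ext_pinv _ _ c [:: (e, false)]); rewrite /= -dc eqxx.
Qed.

Lemma ulift_pathP c p : walk (cend c) p ->
  [/\ map uproj (ulift_path c p) = p,
      walk (c : vert ugraph) (ulift_path c p)
    & wend (c : vert ugraph) (ulift_path c p) = ext c p].
Proof.
elim: p c => [|d p IH] c; first by rewrite ext_nil.
move=> w; have /= /andP[/eqP dc wp] := w.
have [u /= -> [pu su tu]] := udartP dc.
have wp' : walk (cend (ext c [:: d])) p by rewrite cend_ext /= ?dc ?eqxx.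
have [mp ww ew] := IH _ wp'.
rewrite /= mp pu su eqxx tu ww; split=> //.
by rewrite -[d :: p]cat1s ext_cat// -ew /wend /= tu.
Qed.

Definition ubase (f : uface) : vert ugraph := (val f).1.
Definition ubdry (f : uface) := ulift_path (val f).1 (bdry (val f).2).

Lemma uface_walk (f : uface) : walk (cend (val f).1) (bdry (val f).2).
Proof. by rewrite (eqP (valP f)) bdry_walk. Qed.

Lemma ubdry_proj (f : uface) : map uproj (ubdry f) = bdry (val f).2.
Proof. by have [] := ulift_pathP (uface_walk f). Qed.

Lemma ubdry_neq0 f : ubdry f != [::].
Proof.
have := bdry_neq0 (val f).2; rewrite -ubdry_proj.
by case: (ubdry f).
Qed.

Lemma ubdry_walk f : walk (ubase f) (ubdry f).
Proof. by have [] := ulift_pathP (uface_walk f). Qed.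

Lemma ubdry_loop f : wend (ubase f) (ubdry f) = ubase f.
Proof.
have [_ _ ->] := ulift_pathP (uface_walk f).
exact/ext_bdry/eqP/(valP f).
Qed.

Definition universal_cover : complex2 :=
  Complex2 ubdry_neq0 ubdry_walk ubdry_loop.

Lemma uact_proof (K : choiceType) (h : K -> vert X) (g : pi1 x0) (ck : ulift h) :
  cend (act g (val ck).1) == h (val ck).2.
Proof. by rewrite cend_act (eqP (valP ck)). Qed.

Definition uact (K : choiceType) (h : K -> vert X) (g : pi1 x0) (ck : ulift h) : ulift h :=
  exist _ (act g (val ck).1, (val ck).2) (uact_proof g ck).

Lemma usrc_act g e : usrc (uact g e) = act g (usrc e).
Proof. by []. Qed.

Lemma utgt_act g e : utgt (uact g e) = act g (utgt e).
Proof. by rewrite /utgt /= act_ext//= (eqP (valP e)) /dsrc /= eqxx. Qed.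

End UniversalCover.

Section Quotient.
Variables (X : complex2) (x0 : vert X) (N : set (pi1 x0)).

Section Orbits.
Variables (T : choiceType) (a : pi1 x0 -> T -> T).

Definition orbit (x : T) : set T := [set a g x | g in N].

Definition orbits := {A : set T | `[< exists x, A = orbit x >]}.

Lemma orbit_proof x : `[< exists y, orbit x = orbit y >].
Proof. by apply/asboolP; exists x. Qed.

Definition to_orbit x : orbits := exist _ (orbit x) (orbit_proof x).

Lemma orbits_ex (A : orbits) : exists x, to_orbit x = A.
Proof. by have /asboolP[x xA] := valP A; exists x; apply: val_inj. Qed.

Definition orbit_repr (A : orbits) : T := projT1 (cid (orbits_ex A)).

Lemma orbit_reprK A : to_orbit (orbit_repr A) = A.
Proof. exact: projT2 (cid (orbits_ex A)). Qed.

End Orbits.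

Lemma to_orbit_morph (T T' : choiceType) (a : pi1 x0 -> T -> T)
    (a' : pi1 x0 -> T' -> T') (h : T -> T') :
  (forall g x, h (a g x) = a' g (h x)) ->
  forall x y, to_orbit a x = to_orbit a y -> to_orbit a' (h x) = to_orbit a' (h y).
Proof.
move=> ha x y /(congr1 val) /= xy.
have E z : orbit a' (h z) = h @` orbit a z.
  apply/seteqP; split => [_ [g Ng <-]|_ [_ [g Ng <-] <-]].
    by exists (a g z) => //; exists g.
  by exists g.
by apply: val_inj; rewrite /= !E xy.
Qed.

Local Notation U := (universal_cover x0).
Definition qvert := orbits (@act X x0).
Definition qedge := orbits (@uact X x0 _ (@src X)).
Definition qface := orbits (@uact X x0 _ (@base X)).

Definition qv (c : vert U) : qvert := to_orbit _ c.
Definition qe (e : edge U) : qedge := to_orbit _ e.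

Definition qsrc (A : qedge) : qvert := qv (usrc (orbit_repr A)).
Definition qtgt (A : qedge) : qvert := qv (utgt (orbit_repr A)).
Definition qgraph := @Graph qvert qedge qsrc qtgt.

Definition qdart (d : dart U) : dart qgraph := (qe d.1, d.2).

Lemma qsrcE e : qsrc (qe e) = qv (usrc e).
Proof. exact: (to_orbit_morph (@usrc_act X x0) (orbit_reprK (qe e))). Qed.

Lemma qtgtE e : qtgt (qe e) = qv (utgt e).
Proof. exact: (to_orbit_morph (@utgt_act X x0) (orbit_reprK (qe e))). Qed.

Lemma dsrc_qdart d : dsrc (qdart d) = qv (dsrc d).
Proof. by case: d => e []; rewrite /dsrc /= ?qsrcE ?qtgtE. Qed.

Lemma dtgt_qdart d : dtgt (qdart d) = qv (dtgt d).
Proof. by case: d => e []; rewrite /dtgt /= ?qsrcE ?qtgtE. Qed.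

Lemma wend_qdart c p : wend (qv c : vert qgraph) (map qdart p) = qv (wend c p).
Proof.
elim: p c => //= d p IH c.
by rewrite -[LHS]/(wend (dtgt (qdart d)) (map qdart p)) dtgt_qdart IH.
Qed.

Lemma walk_qdart c p : walk c p -> walk (qv c : vert qgraph) (map qdart p).
Proof.
elim: p c => //= d p IH c /andP[/eqP<- wp].
by rewrite dsrc_qdart eqxx dtgt_qdart IH.
Qed.

Definition qbase (A : qface) : vert qgraph := qv (@base U (orbit_repr A)).
Definition qbdry (A : qface) : seq (dart qgraph) :=
  map qdart (@bdry U (orbit_repr A)).

Lemma qbdry_neq0 A : qbdry A != [::].
Proof.
have := @bdry_neq0 U (orbit_repr A).
by rewrite /qbdry; case: (bdry _).
Qed.

Lemma qbdry_walk A : walk (qbase A) (qbdry A).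
Proof. exact/walk_qdart/(@bdry_walk U). Qed.

Lemma qbdry_loop A : wend (qbase A) (qbdry A) = qbase A.
Proof. by rewrite wend_qdart (@bdry_loop U). Qed.

(* The quotient of the universal cover by N, meant for N a subgroup of the
   fundamental group; its cells are the N-orbits of cells, and the attaching
   loop of a 2-cell is the image of that of a lift. *)
Definition cover : complex2 := Complex2 qbdry_neq0 qbdry_walk qbdry_loop.

End Quotient.

Section Rank.
Variable V : zmodType.

Definition zcomb n (S : 'I_n -> V) (a : 'I_n -> int) : V :=
  \sum_(j < n) S j *~ a j.

Definition zspan n (S : 'I_n -> V) : set V := [set zcomb S a | a in setT].

Definition zfree n (S : 'I_n -> V) :=
  forall a, zcomb S a = 0 -> forall j, a j = 0.

(* The rank of the subgroup A is n. *)
Definition has_rank (A : set V) n :=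
  (exists2 S : 'I_n -> V, (forall j, A (S j)) & zfree S) /\
  ~ exists2 S : 'I_n.+1 -> V, (forall j, A (S j)) & zfree S.

(* The junk value 0 is only used for subgroups of infinite rank. *)
Definition zrank (A : set V) : nat := xget 0%N [set n | has_rank A n].

End Rank.

Section Chains.
Variable X : complex2.

Definition chain (K : choiceType) := {freeg K / int}.

Definition chain_norm (K : choiceType) (A : chain K) : nat :=
  \sum_(x <- dom A) `|coeff x A|%N.

Definition bdry_face (f : face X) : chain (edge X) :=
  \sum_(d <- bdry f) (if d.2 then << d.1 >> else - << d.1 >>).

Definition bdry2 (A : chain (face X)) : chain (edge X) := fglift bdry_face A.

Definition boundaries1 : set (chain (edge X)) := range bdry2.

(* H_2(X; Z), as there are no 3-cells. *)
Definition cycles2 : set (chain (face X)) := [set A | bdry2 A = 0].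

Variable R : realType.

Definition fill1 (z : chain (edge X)) : R :=
  inf [set (chain_norm A)%:R | A in [set A | bdry2 A = z]].

(* The infimum is +oo when there is no nonzero boundary. *)
Definition rho1 : \bar R :=
  ereal_inf [set ((chain_norm z)%:R / fill1 z)%:E |
             z in [set z | boundaries1 z /\ z <> 0]].

Definition xi2 : R :=
  let b := zrank cycles2 in
  if b == 0%N then 0 else
  inf [set (\max_(j < b) chain_norm (S j))%:R |
       S in [set S : 'I_b -> chain (face X) |
             (forall j, cycles2 (S j)) /\ zrank (zspan S) = b]].

End Chains.

(* Main.v *)
(* Let N be one of the groups, n its index, Y = cover N, D = [N, N] and
   T = #N^ab. By property (tau) the Cayley graph of the group modulo D, which
   has nT vertices, has diameter O(log n + log T). So every edge e of the cover
   with group D closes up, through short paths from the base point, to a loop of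
   length O(log n + log T) with class in D; its image in Y is a boundary, and
   has a filling A(e) of norm O(log n + log T) / rho_1(Y), which by hypothesis
   is O(xi_2(Y) (log n + log T) / n). Along the boundary of a face s of that
   cover the loops telescope, so s minus the sum of the A(e) over the edges of
   its boundary is a 2-cycle of Y. Summing these 2-cycles over the T lifts of a
   face s of Y gives T s - Psi(d s) for a homomorphism Psi, hence they span
   H_2(Y; Q), and xi_2(Y) is at most the largest of their norms:
     xi_2(Y) <= 1 + O(xi_2(Y) (log n + log T) / n).
   As xi_2(Y) is at least of order n (compare with the filling of the boundary
   of one face), log n + log T is at least of order n. *)
Require Import Defs.
From HB Require Import structures.
From mathcomp Require Import ring lra zify.

Set Implicit Arguments.
Unset Strict Implicit.
Unset Printing Implicit Defensive.

Import Order.TTheory GRing.Theory Num.Theory.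

Local Open Scope classical_set_scope.
Local Open Scope ring_scope.

(** * Spectral gap and expansion *)

(** Property (tau) concerns subgroups of finite index only, so it applies to D = [N, N] only once
    N^ab is known to be finite. That is deduced from the gap too, through the subgroups between D
    and N.

    The sum over the T lifts yields a homomorphism Psi because paths and fillings are chosen
    invariantly under D: two lifts of an edge of Y differ by an element of N, which merely permutes
    the cosets of D and hence the summands.

    If every 2-cell of Y has zero boundary, rho_1(Y) is +oo and the hypothesis gives no lower bound
    of order n for xi_2(Y). Then every closed path of Y is null as a chain, the 1-skeleton is a tree
    and N is trivial, which cannot happen in a chain whose indices tend to infinity.

    The inequality for xi_2(Y) is used by absorption: if n exceeds a suitable multiple of the length
    of the loops, the correction is at most xi_2(Y) / 2, so xi_2(Y) <= 2 and n is bounded. *)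

Lemma continuous_sum (R : realType) (T : topologicalType) (I : Type)
    (r : seq I) (F : I -> T -> R) :
  (forall i, continuous (F i)) -> continuous (fun x => \sum_(i <- r) F i x).
Proof.
move=> cF; elim: r => [|i r IH].
  by under eq_fun do rewrite big_nil; exact: cst_continuous.
under eq_fun do rewrite big_cons.
by move=> x; apply: cvgD; [exact: cF|exact: IH].
Qed.

Section Rayleigh.
Variables (R : realType) (m : nat).
Implicit Types (u v w : 'rV[R]_m) (L : 'M[R]_m).

Definition dotmx u v : R := \sum_i u 0 i * v 0 i.

Lemma dotmxC u v : dotmx u v = dotmx v u.
Proof. by apply: eq_bigr => i _; rewrite mulrC. Qed.

Lemma dotmxDl u v w : dotmx (u + v) w = dotmx u w + dotmx v w.
Proof. by rewrite -big_split; apply: eq_bigr => i _; rewrite mxE mulrDl. Qed.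

Lemma dotmxZl a u w : dotmx (a *: u) w = a * dotmx u w.
Proof. by rewrite big_distrr; apply: eq_bigr => i _; rewrite mxE /= mulrA. Qed.

Lemma dotmxDr u v w : dotmx w (u + v) = dotmx w u + dotmx w v.
Proof. by rewrite dotmxC dotmxDl !(dotmxC w). Qed.

Lemma dotmxZr a u w : dotmx w (a *: u) = a * dotmx w u.
Proof. by rewrite dotmxC dotmxZl dotmxC. Qed.

Lemma dotmx_ge0 u : 0 <= dotmx u u.
Proof. by apply: sumr_ge0 => i _; rewrite -expr2 sqr_ge0. Qed.

Lemma dotmx_eq0 u : dotmx u u = 0 -> u = 0.
Proof.
move=> /eqP; rewrite psumr_eq0 => [|i _]; last by rewrite -expr2 sqr_ge0.
move=> /allP u0; apply/rowP => i; rewrite mxE.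
by have := u0 i (mem_index_enum i); rewrite /= mulf_eq0 orbb => /eqP.
Qed.

Lemma dotmx_sym L u v : L^T = L -> dotmx (u *m L) v = dotmx u (v *m L).
Proof.
move=> Ls; transitivity (\sum_i \sum_j u 0 j * L j i * v 0 i).
  by apply: eq_bigr => i _; rewrite mxE mulr_suml.
rewrite exchange_big /=; apply: eq_bigr => j _.
rewrite mxE mulr_sumr; apply: eq_bigr => i _.
by rewrite -[in RHS]Ls mxE; ring.
Qed.

Lemma continuous_dotmx (T : topologicalType) (f g : T -> 'rV[R]_m) :
  (forall i, continuous (fun x => f x 0 i)) ->
  (forall i, continuous (fun x => g x 0 i)) ->
  continuous (fun x => dotmx (f x) (g x)).
Proof.
move=> cf cg; apply: continuous_sum => i x.
by apply: cvgM; [exact: cf|exact: cg].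
Qed.

Let one : 'rV[R]_m := const_mx 1.

(* A minimizer of the quadratic form on the unit sphere of the functions of mean
   zero is an eigenvector, as the form minus its minimum is nonnegative there. *)
Lemma rayleigh_ge L (eps : R) : L^T = L -> one *m L = 0 ->
  (forall lam u, u != 0 -> dotmx u one = 0 -> u *m L = lam *: u -> eps <= lam) ->
  forall u, dotmx u one = 0 -> eps * dotmx u u <= dotmx (u *m L) u.
Proof.
move=> Ls L1 gap.
pose A := [set u | dotmx u one = 0 /\ dotmx u u = 1].
have cc i : continuous (fun u : 'rV[R]_m => u 0 i) by exact: coord_continuous.
have cA : compact A.
  apply: bounded_closed_compact.
    rewrite /bounded_set /=; exists 1; split=> // M M1 u [_ u1].
    apply: le_trans (ltW M1); rewrite -[ `|u| ]/(mx_norm u).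
    have [->//|/mx_norm_neq0[[i j] ->/=]] := eqVneq (mx_norm u) 0.
    rewrite (ord1 i) -[leRHS]ger0_norm// -ler_sqr ?nnegrE// !real_normK ?num_real//.
    rewrite expr1n -u1 /dotmx (bigD1 j)//= -expr2 lerDl.
    by apply: sumr_ge0 => k _; rewrite -expr2 sqr_ge0.
  have -> : A = (fun u => dotmx u one) @^-1` [set 0] `&` (fun u => dotmx u u) @^-1` [set 1].
    by [].
  apply: closedI; apply: closed_comp; try exact: closed_eq.
    move=> u _; apply: continuous_dotmx => // i; exact: cst_continuous.
  move=> u _; exact: continuous_dotmx.
pose Q u := dotmx (u *m L) u.
have cQ : continuous Q.
  apply: continuous_dotmx => // i.
  under eq_fun do rewrite mxE.
  apply: (@continuous_sum _ _ _ _ (fun j (u : 'rV[R]_m) => u 0 j * L j i)) => j u.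
  exact: (@continuousM _ _ (fun u : 'rV[R]_m => u 0 j) (fun=> L j i) u (cc j u)
    (@cst_continuous _ _ _ u)).
move=> u u0.
have [->|un0] := eqVneq u 0.
  have d0 v : dotmx v 0 = 0 by apply: big1 => i _; rewrite mxE mulr0.
  by rewrite !d0 mulr0.
have norm v : v != 0 -> dotmx v one = 0 ->
    let r := Num.sqrt (dotmx v v) in 0 < r /\ A (r^-1 *: v).
  move=> v0 v1 r.
  have r0 : 0 < r.
    rewrite sqrtr_gt0 lt_neqAle dotmx_ge0 andbT eq_sym.
    by apply: contra_neq v0 => /dotmx_eq0.
  split=> //; split; first by rewrite dotmxZl v1 mulr0.
  rewrite dotmxZl dotmxZr mulrA -invfM -expr2 sqr_sqrtr ?dotmx_ge0//.
  by rewrite mulVf// gt_eqF// -sqrtr_gt0.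
have [c cAA cmin] : exists2 c, c \in A & forall v, v \in A -> Q c <= Q v.
  apply: compact_EVT_min => //; last exact: continuous_subspaceT.
  by have [_ Au] := norm u un0 u0; exists ((Num.sqrt (dotmx u u))^-1 *: u).
have [c0 c1] : A c by rewrite inE in cAA.
pose lam := Q c; pose P v := Q v - lam * dotmx v v.
have P0 v : dotmx v one = 0 -> 0 <= P v.
  move=> v1; have [->|v0] := eqVneq v 0.
    have d0 w : dotmx w 0 = 0 by apply: big1 => i _; rewrite mxE mulr0.
    by rewrite /P /Q !d0 mulr0 subrr.
  have [r0 Ar] := norm v v0 v1; set r := Num.sqrt _ in r0 Ar.
  have /cmin : r^-1 *: v \in A by rewrite inE.
  rewrite /Q -scalemxAl dotmxZl dotmxZr mulrA -invfM -expr2 sqr_sqrtr ?dotmx_ge0//.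
  by rewrite ler_pdivlMl -1?sqrtr_gt0// mulrC subr_ge0.
(* The error in the eigenvalue equation, half the gradient of [P] at [c]. By [Pch] below, a nonzero
   [h] would make [P (c + t *: h)] negative for small negative [t]. *)
have [h hE] : exists h, h = c *m L - lam *: c by eexists.
have h1 : dotmx h one = 0.
  rewrite hE dotmxDl dotmx_sym// L1 -scaleNr dotmxZl c0 mulr0 addr0.
  by apply: big1 => i _; rewrite mxE mulr0.
have Pch t : P (c + t *: h) = t * (2 * dotmx h h + t * P h).
  have hc : dotmx h c = 0.
    by rewrite hE dotmxDl -scaleNr dotmxZl c1 -/(Q c) -/lam mulr1 subrr.
  have e : c *m L = h + lam *: c by rewrite hE subrK.
  have hLc : dotmx (h *m L) c = dotmx h h.
    by rewrite dotmx_sym// e dotmxDr dotmxZr hc mulr0 addr0.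
  have cLh : dotmx (c *m L) h = dotmx h h.
    by rewrite e dotmxDl dotmxZl (dotmxC c) hc mulr0 addr0.
  rewrite /P /Q mulmxDl -scalemxAl !(dotmxDl, dotmxDr, dotmxZl, dotmxZr).
  rewrite hLc cLh (dotmxC c h) hc c1 -/(Q c) -/lam; lra.
have hh : dotmx h h = 0.
  apply/eqP; rewrite eq_le dotmx_ge0 andbT leNgt; apply/negP => hp.
  have Ph := P0 h h1.
  (* Small enough that [t * P h] cannot outweigh [dotmx h h]; the [+ 1] allows for [P h = 0]. *)
  pose t := - (dotmx h h / (P h + 1)).
  have t0 : 0 < dotmx h h / (P h + 1) by rewrite divr_gt0//; lra.
  have tp : dotmx h h / (P h + 1) * P h <= dotmx h h.
    rewrite mulrAC ler_pdivrMr; last lra.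
    by rewrite ler_wpM2l ?dotmx_ge0//; lra.
  have : 0 <= P (c + t *: h).
    by apply: P0; rewrite dotmxDl dotmxZl c0 h1 mulr0 addr0.
  rewrite Pch /t => H.
  have : 0 < dotmx h h / (P h + 1) * (2 * dotmx h h + t * P h).
    by apply: mulr_gt0 => //; rewrite /t; nra.
  by rewrite /t; lra.
have elam : eps <= lam.
  apply: (gap _ c) => //; last first.
    by apply/eqP; rewrite -subr_eq0 -hE; apply/eqP/dotmx_eq0.
  apply: contra_eq_neq c1 => ->; rewrite /dotmx big1 ?(eq_sym 0) ?oner_eq0// => i _.
  by rewrite mxE mulr0.
have := P0 u u0; rewrite /P /Q subr_ge0; apply: le_trans.
by rewrite ler_wpM2r ?dotmx_ge0.
Qed.
End Rayleigh.

Section Expansion.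
Variables (R : realType) (m : nat) (T : Type) (S : seq T).
Variables (sig tau : T -> 'I_m -> 'I_m) (eps : R).
Hypothesis sigK : forall s, cancel (sig s) (tau s).
Hypothesis tauK : forall s, cancel (tau s) (sig s).
Hypothesis gap : forall (lam : R) (f : 'I_m -> R),
  (exists i, f i != 0) -> \sum_i f i = 0 ->
  (forall i, \sum_(s <- S) ((f i - f (sig s i)) + (f i - f (tau s i))) = lam * f i) ->
  eps <= lam.

(** The right-hand side is the Laplacian paired with [f]: as [tau s] inverts [sig s], reindexing
    turns the terms along [tau s] into terms along [sig s]. For the same reason the matrix [L] is
    symmetric, as [rayleigh_ge] requires. *)
Lemma poincare (f : 'I_m -> R) : \sum_i f i = 0 ->
  eps * \sum_i f i ^+ 2 <= \sum_(s <- S) \sum_i (f i - f (sig s i)) ^+ 2.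
Proof.
pose L : 'M[R]_m := \sum_(s <- S)
  \matrix_(j, i) ((j == i)%:R *+ 2 - (j == sig s i)%:R - (j == tau s i)%:R).
have LE (u : 'rV[R]_m) i : (u *m L) 0 i =
    \sum_(s <- S) ((u 0 i - u 0 (sig s i)) + (u 0 i - u 0 (tau s i))).
  rewrite /L mulmx_sumr summxE; apply: eq_bigr => s _; rewrite mxE.
  have pick k : \sum_j u 0 j * (j == k)%:R = u 0 k.
    rewrite (bigD1 k)//= eqxx mulr1 big1 ?addr0// => j /negbTE->.
    by rewrite mulr0.
  under eq_bigr do rewrite mxE !mulrBr mulrnAr.
  by rewrite !sumrB sumrMnl !pick; ring.
have Ls : L^T = L.
  rewrite /L raddf_sum; apply: eq_bigr => s _; apply/matrixP => i j; rewrite !mxE.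
  have -> : (j == sig s i) = (i == tau s j) by apply/eqP/eqP => ->; rewrite ?sigK ?tauK.
  have -> : (j == tau s i) = (i == sig s j) by apply/eqP/eqP => ->; rewrite ?sigK ?tauK.
  by rewrite (eq_sym j); ring.
have L1 : (const_mx 1 : 'rV[R]_m) *m L = 0.
  apply/rowP => i; rewrite LE big1 ?mxE// => s _; rewrite !mxE; ring.
move=> f0; pose u : 'rV[R]_m := \row_i f i.
have dot1 (v : 'rV[R]_m) : dotmx v (const_mx 1) = \sum_i v 0 i.
  by apply: eq_bigr => i _; rewrite mxE mulr1.
have := @rayleigh_ge R m L eps Ls L1 _ u.
rewrite dot1 /dotmx.
under eq_bigr do rewrite mxE.
under [X in eps * X]eq_bigr do rewrite mxE -expr2.
under [X in _ <= X]eq_bigr do rewrite LE.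
move=> H; apply: le_trans (H _ f0) _.
  move=> lam v v0 v1 vL; apply: (gap (f := v 0)).
  - by apply/rV0Pn.
  - by rewrite -dot1.
  - by move=> i; rewrite -LE vL mxE.
under eq_bigr do rewrite mulr_suml.
rewrite exchange_big /=; apply: ler_sum => s _.
have -> : \sum_i (f i - f (sig s i)) ^+ 2 =
    \sum_i (f i ^+ 2 - f i * f (sig s i)) + \sum_i (f (sig s i) ^+ 2 - f i * f (sig s i)).
  by rewrite -big_split /=; apply: eq_bigr => i _; ring.
rewrite [X in _ <= _ + X](reindex_inj (can_inj (tauK s))) /=.
rewrite -big_split /= le_eqVlt; apply/orP; left; apply/eqP/eq_bigr => i _.
by rewrite !mxE tauK; ring.
Qed.

(** The Poincare inequality for the indicator of [B] minus its mean [#|B| / m]. *)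
Lemma edge_expansion (B : {set 'I_m}) :
  eps * (#|B| * (m - #|B|))%:R <=
  m%:R * (\sum_(s <- S) #|[pred i | (i \in B) (+) (sig s i \in B)]|)%:R.
Proof.
have [m0|m0] := eqVneq m 0%N.
  have /eqP-> : (m - #|B| == 0)%N.
    by rewrite -leqn0; apply: leq_trans (leq_subr _ _) _; rewrite m0.
  by rewrite muln0 mulr0 mulr_ge0.
have mR : (m%:R : R) != 0 by rewrite pnatr_eq0.
have cB : (#|B| <= m)%N by rewrite -[X in (_ <= X)%N]card_ord max_card.
pose f i : R := (i \in B)%:R - #|B|%:R / m%:R.
have sB : \sum_i ((i \in B)%:R : R) = #|B|%:R.
  by rewrite -sum1_card natr_sum [RHS]big_mkcond; apply: eq_bigr => i _; case: (i \in B).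
have := @poincare f; rewrite sumrB sB sumr_const card_ord -[_ *+ m]mulr_natr divfK// subrr.
move=> /(_ erefl).
have -> : \sum_i f i ^+ 2 = (#|B| * (m - #|B|))%:R / m%:R.
  transitivity (\sum_i ((i \in B)%:R * (1 - 2 * (#|B|%:R / m%:R)) + (#|B|%:R / m%:R) ^+ 2) : R).
    by apply: eq_bigr => i _; rewrite /f; case: (i \in B) => /=; ring.
  rewrite big_split /= -mulr_suml sB sumr_const card_ord -[_ *+ m]mulr_natr natrM natrB//.
  by field.
rewrite mulrA ler_pdivrMr ?ltr0n ?lt0n// => /le_trans; apply.
rewrite mulrC ler_wpM2l ?ler0n// natr_sum ler_sum// => s _.
rewrite -sum1_card natr_sum [leRHS]big_mkcond ler_sum// => i _.
by rewrite inE /f; case: (i \in B); case: (sig s i \in B) => /=; rewrite ?addrK ?subrr; nra.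
Qed.
End Expansion.

(** * Cosets, words and diameters *)

Section Cosets.
Variable G : groupType.
Implicit Types (g h x y s : G) (A H N : set G).

Lemma subgroup1 H : subgroup H -> H 1%g. Proof. by case. Qed.
Lemma subgroupM H x y : subgroup H -> H x -> H y -> H (x * y)%g.
Proof. by case=> _ HM _; exact: HM. Qed.
Lemma subgroupV H x : subgroup H -> H x -> H (x^-1)%g.
Proof. by case=> _ _; exact. Qed.
Lemma subgroupVE H x : subgroup H -> H (x^-1)%g <-> H x.
Proof. by move=> sH; split=> /(subgroupV sH); rewrite ?invgK. Qed.
Lemma subgroupX H x n : subgroup H -> H x -> H (x ^+ n)%g.
Proof.
move=> sH Hx; elim: n => [|n IH]; first exact: subgroup1.
by rewrite expgS; exact: subgroupM.
Qed.

Lemma lcoset_eq H g h : subgroup H -> lcoset g H = lcoset h H <-> H (g^-1 * h)%g.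
Proof.
move=> sH; split=> [E|Hgh].
  have : lcoset h H h by exists 1%g; rewrite ?mulg1//; exact: subgroup1.
  by rewrite -E => -[k Hk <-]; rewrite mulKg.
apply/seteqP; split=> _ [k Hk <-].
  exists ((g^-1 * h)^-1 * k)%g; first by apply: subgroupM => //; exact: subgroupV.
  by rewrite invgM invgK !mulgA mulgV mul1g.
exists (g^-1 * h * k)%g; first exact: subgroupM.
by rewrite !mulgA mulgV mul1g.
Qed.

Lemma lcosets_in H g : lcosets [set: G] H (lcoset g H).
Proof. by exists g. Qed.

Lemma normal_conj N g x : normal_subgroup N -> N x -> N (g * x * g^-1)%g.
Proof. by case=> _ /(_ (g^-1)%g x) H /H; rewrite conjgE invgK mulgA. Qed.

Definition rtrans s A : set G := [set (a * s)%g | a in A].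

Lemma rtrans_lcoset N g s : normal_subgroup N ->
  rtrans s (lcoset g N) = lcoset (g * s)%g N.
Proof.
move=> nN; apply/seteqP; split.
  move=> _ [_ [k Nk <-] <-]; exists (k ^ s)%g; first exact: nN.2.
  by rewrite conjgE !mulgA mulgK.
move=> _ [k Nk <-]; exists (g * (s * k * s^-1))%g; last by rewrite !mulgA mulgVK.
by exists (s * k * s^-1)%g => //; exact: normal_conj.
Qed.

Lemma lcosetM N g h g' h' : normal_subgroup N ->
  lcoset g N = lcoset g' N -> lcoset h N = lcoset h' N ->
  lcoset (g * h)%g N = lcoset (g' * h')%g N.
Proof.
move=> nN gg /(lcoset_eq _ _ nN.1) hh.
rewrite -rtrans_lcoset// gg rtrans_lcoset//; apply/lcoset_eq; first exact: nN.1.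
by rewrite invgM -mulgA mulKg.
Qed.

Lemma lcosetV N g h : normal_subgroup N ->
  lcoset g N = lcoset h N -> lcoset g^-1 N = lcoset h^-1 N.
Proof.
move=> nN /(lcoset_eq _ _ nN.1) gh; apply/lcoset_eq; first exact: nN.1.
rewrite invgK; have := normal_conj h nN (subgroupV nN.1 gh).
by rewrite invgM invgK !mulgA mulgV mul1g.
Qed.

Lemma lcosetN H g : subgroup H -> lcoset g H = lcoset 1 H <-> H g.
Proof.
move=> sH; rewrite lcoset_eq// mulg1; exact: subgroupVE.
Qed.

Lemma mem_lcosets H g : finite_index H ->
  lcoset g H \in fset_set (lcosets [set: G] H).
Proof. by move=> fH; rewrite in_fset_set// inE; exact: lcosets_in. Qed.

Lemma gindex_gt0 H : finite_index H -> (0 < gindex [set: G] H)%N.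
Proof.
move=> fH; rewrite /gindex cardfs_gt0; apply/fset0Pn.
by exists (lcoset 1 H); exact: mem_lcosets.
Qed.

Variable S : seq G.

Definition letters := S ++ map (fun s => s^-1)%g S.

Definition wprod (w : seq G) : G := foldr (fun x y => x * y)%g 1%g w.

Lemma wprod_cat v w : wprod (v ++ w) = (wprod v * wprod w)%g.
Proof. by elim: v => [|a v IH]; rewrite /= ?mul1g// IH mulgA. Qed.

Definition word_ball r : set G :=
  [set x | exists w, [/\ {subset w <= letters}, (size w <= r)%N & wprod w = x]].

Lemma word_ball1 r : word_ball r 1%g.
Proof. by exists [::]. Qed.

Lemma word_ballM r r' x y :
  word_ball r x -> word_ball r' y -> word_ball (r + r') (x * y)%g.
Proof.
move=> [v [vS sv <-]] [w [wS sw <-]]; exists (v ++ w); split.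
- by move=> a; rewrite mem_cat => /orP[/vS|/wS].
- by rewrite size_cat leq_add.
- exact: wprod_cat.
Qed.

Lemma word_ballW r r' x : (r <= r')%N -> word_ball r x -> word_ball r' x.
Proof. by move=> rr [w [wS sw <-]]; exists w; split=> //; exact: leq_trans rr. Qed.

Lemma word_ball_letter s : s \in letters -> word_ball 1 s.
Proof.
by move=> sS; exists [:: s]; split=> [a|//|]; rewrite ?inE /= ?mulg1// => /eqP->.
Qed.

Lemma letters_inv s : s \in letters -> (s^-1)%g \in letters.
Proof.
rewrite !mem_cat => /orP[sS|/mapP[t tS ->]]; apply/orP.
  by right; exact: map_f.
by left; rewrite invgK.
Qed.

Lemma word_ballV r x : word_ball r x -> word_ball r (x^-1)%g.
Proof.
move=> [w [+ + <-]]; elim: w r => [|a w IH] r wS sw /=.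
  by rewrite invg1; exact: word_ball1.
case: r sw => // r sw; rewrite invgM -addn1.
apply: word_ballM; first by apply: IH => // b bw; apply: wS; rewrite inE bw orbT.
by apply/word_ball_letter/letters_inv/wS; rewrite inE eqxx.
Qed.

Lemma generated_word_ball : generated [set` S] = [set: G] ->
  forall x, exists r, word_ball r x.
Proof.
move=> gS x; have : generated [set` S] x by rewrite gS.
move=> /(_ [set x | exists r, word_ball r x]); apply.
  split=> [|{}x y [r rx] [r' ry]|{}x [r rx]].
  - by exists 0%N; exact: word_ball1.
  - by exists (r + r')%N; exact: word_ballM.
  - by exists r; exact: word_ballV.
move=> s sS; exists 1%N; apply: word_ball_letter.
by rewrite mem_cat; apply/orP; left.
Qed.

End Cosets.

Lemma count_fset (T : choiceType) (A B : {fset T}) : (A `<=` B)%fset ->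
  count (mem A) B = #|` A|.
Proof.
move=> AB; rewrite -size_filter; apply/perm_size/uniq_perm.
- by rewrite filter_uniq.
- by [].
- move=> x; rewrite mem_filter /=; apply/andP/idP => [[]//|xA].
  by split=> //; exact: (fsubsetP AB).
Qed.

Section CosetBall.
Variables (G : groupType) (S : seq G) (N : set G).
Hypotheses (nN : normal_subgroup N) (fN : finite_index N).

Let Q : {fset set G} := fset_set (lcosets [set: G] N).
Let m := gindex [set: G] N.

Definition coset_ball r : {fset set G} :=
  fset_set [set lcoset x N | x in word_ball S r].

Let finB r : finite_set [set lcoset x N | x in word_ball S r].
Proof. by apply: sub_finite_set fN => _ [x _ <-]; exact: lcosets_in. Qed.

Lemma coset_ballP r A :
  reflect (exists2 x, word_ball S r x & lcoset x N = A) (A \in coset_ball r).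
Proof. by apply: (iffP idP); rewrite in_fset_set// inE. Qed.

Lemma coset_ball_sub r : (coset_ball r `<=` Q)%fset.
Proof.
by apply/fsubsetP => _ /coset_ballP[x _ <-]; exact: mem_lcosets.
Qed.

Lemma coset_ball_subS r : (coset_ball r `<=` coset_ball r.+1)%fset.
Proof.
apply/fsubsetP => A /coset_ballP[x xr <-]; apply/coset_ballP.
by exists x => //; exact: word_ballW xr.
Qed.

(* If more than half of the cosets are within distance r of N, the balls of
   radius r around any two cosets meet. *)
Lemma half_ball_diam r g : (m < 2 * #|` coset_ball r|)%N ->
  exists2 x, word_ball S (r + r) x & lcoset x N = lcoset g N.
Proof.
(* Sends x N to g x^-1 N, injectively. Where the image of the ball meets the ball, y N = g x^-1 N,
   and [y * x] is the element sought. *)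
move=> half; pose phi (A : set G) : set G := [set (g * a^-1)%g | a in A].
have phiE x : phi (lcoset x N) = lcoset (g * x^-1)%g N.
  apply/seteqP; split=> [_ [_ [k Nk <-] <-]|_ [k Nk <-]].
    exists (x * k^-1 * x^-1)%g; first exact: normal_conj nN (subgroupV nN.1 Nk).
    by rewrite invgM !mulgA mulgVK.
  exists (x * (x^-1 * k^-1 * x))%g.
    exists (x^-1 * k^-1 * x)%g => //.
    by rewrite -[X in (_ * X)%g]invgK; exact: normal_conj nN (subgroupV nN.1 Nk).
  by rewrite !invgM !invgK !mulgA mulgK.
pose C := (phi @` coset_ball r)%fset.
have cC : #|` C| = #|` coset_ball r|.
  apply: card_in_imfset => _ _ /coset_ballP[x _ <-] /coset_ballP[y _ <-].
  rewrite !phiE => /(lcosetV nN); rewrite !invgM !invgK => E.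
  have := lcosetM nN E (erefl (lcoset g N)); by rewrite !mulgVK.
have CQ : (C `<=` Q)%fset.
  apply/fsubsetP => _ /imfsetP[_ /coset_ballP[x _ <-] ->].
  by rewrite phiE; exact: mem_lcosets.
have : (coset_ball r `&` C)%fset != fset0.
  rewrite -cardfs_gt0.
  have : (#|` (coset_ball r `|` C)%fset| <= m)%N.
    by apply: fsubset_leq_card; rewrite fsubUset coset_ball_sub CQ.
  have := cardfsUI (coset_ball r) C; rewrite cC; lia.
move=> /fset0Pn[A]; rewrite in_fsetI => /andP[/coset_ballP[y yr <-]].
move=> /imfsetP[_ /coset_ballP[x xr <-]]; rewrite phiE => E.
exists (y * x)%g; first exact: word_ballM.
by have := lcosetM nN E (erefl (lcoset x N)); rewrite mulgVK.
Qed.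

End CosetBall.

Section Growth.
Variables (G : groupType) (R : realType) (S : seq G) (N : set G) (eps : R).
Hypotheses (nN : normal_subgroup N) (fN : finite_index N).
Hypothesis gapN : spectral_gap_ge S N eps.
Hypothesis eps0 : 0 < eps.

Let Q : {fset set G} := fset_set (lcosets [set: G] N).
Let m := gindex [set: G] N.
Local Notation coset_ball := (coset_ball S N).

(** [edge_expansion] for the Cayley graph of G / N, after numbering the cosets by ['I_m]. *)
Lemma coset_expansion (B : pred (set G)) (b := count B Q) :
  eps * (b * (m - b))%:R <=
  m%:R * (\sum_(s <- S) count (fun A => B A (+) B (rtrans s A)) Q)%:R.
Proof.
pose q (i : 'I_m) : set G := nth set0 Q i.
have qQ i : q i \in Q by exact: mem_nth.
have i0 : 'I_m by exact: Ordinal (gindex_gt0 fN).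
pose idx A : 'I_m := insubd i0 (index A Q).
have qK i : idx (q i) = i.
  apply: val_inj; rewrite val_insubd /q index_uniq ?fset_uniq//.
  by rewrite ltn_ord.
have idxK A : A \in Q -> q (idx A) = A.
  by move=> AQ; rewrite /q /idx val_insubd index_mem AQ nth_index.
have QP A : A \in Q -> exists g, A = lcoset g N.
  by rewrite in_fset_set// inE => -[g _ <-]; exists g.
have rQ s A : A \in Q -> rtrans s A \in Q.
  by move=> /QP[g ->]; rewrite rtrans_lcoset//; exact: mem_lcosets.
have rK s A : A \in Q -> rtrans s^-1 (rtrans s A) = A.
  by move=> /QP[g ->]; rewrite !rtrans_lcoset// mulgK.
have rVK s A : A \in Q -> rtrans s (rtrans s^-1 A) = A.
  by move=> /QP[g ->]; rewrite !rtrans_lcoset// mulgVK.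
pose sig s i := idx (rtrans s (q i)).
pose tau s i := idx (rtrans s^-1 (q i)).
have sigK s : cancel (sig s) (tau s).
  by move=> i; rewrite /sig /tau idxK ?rQ// rK.
have tauK s : cancel (tau s) (sig s).
  by move=> i; rewrite /sig /tau idxK ?rQ// rVK.
have countE (P : pred (set G)) : count P Q = #|[pred i | P (q i)]|.
  rewrite -sum1_count -sum1_card (big_nth set0) big_mkord.
  by apply: eq_bigl => i; rewrite inE.
have gap lam (f : 'I_m -> R) : (exists i, f i != 0) -> \sum_i f i = 0 ->
    (forall i, \sum_(s <- S) ((f i - f (sig s i)) + (f i - f (tau s i))) = lam * f i) ->
    eps <= lam.
  move=> [i fi] f0 fl; apply: (gapN (f := f \o idx)).
  - exists (q i); last by rewrite /= qK.
    by have := qQ i; rewrite in_fset_set// inE.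
  - rewrite (big_nth set0) big_mkord -[RHS]f0; apply: eq_bigr => j _.
    by rewrite /= -[nth _ _ _]/(q j) qK.
  - move=> A AQ; have AQ' : A \in Q by rewrite in_fset_set// inE.
    by rewrite /= -fl; apply: eq_bigr => s _; rewrite /sig /tau idxK.
have := edge_expansion sigK tauK gap [set i | B (q i)]%SET.
have -> : #|[set i | B (q i)]%SET| = b.
  by rewrite /b countE cardsE; apply: eq_card => i; rewrite !inE.
move=> /le_trans; apply; rewrite ler_wpM2l ?ler0n// ler_nat.
rewrite leq_eqVlt; apply/orP; left; apply/eqP; apply: eq_bigr => s _.
rewrite countE; apply: eq_card => i; rewrite !inE.
by rewrite /sig idxK ?rQ.
Qed.

(** Each generator has at most [2 * (b' - b)] edges across the border of the ball, and [m - b] is at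
    least [m / 2]; so expansion reads [eps * b <= 4 * size S * (b' - b)]. The [+ 1] keeps the
    denominator positive when [S] is empty. *)
Let h := eps / (4 * (size S)%:R + 1).

Lemma ball_growth_step r : (2 * #|` coset_ball r| <= m)%N ->
  (1 + h) * (#|` coset_ball r|)%:R <= (#|` coset_ball r.+1|)%:R.
Proof.
move=> rm; set b := #|` coset_ball r|; set b' := #|` coset_ball r.+1|.
have bb' : (b <= b')%N by exact/fsubset_leq_card/coset_ball_subS.
have m0 : (0 < m)%N by exact: gindex_gt0.
have := coset_expansion (mem (coset_ball r)).
rewrite count_fset ?coset_ball_sub// -/b => H.
pose D := (coset_ball r.+1 `\` coset_ball r)%fset.
have DQ : (D `<=` Q)%fset.
  exact: fsubset_trans (fsubsetDl _ _) (coset_ball_sub S fN _).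
have cD : #|` D| = (b' - b)%N.
  by rewrite cardfsD (fsetIidPr (coset_ball_subS S fN r)).
have QP A : A \in Q -> exists g, A = lcoset g N.
  by rewrite in_fset_set// inE => -[g _ <-]; exists g.
(* An edge from A to A s across the border has its outer end in the sphere [D]: that end is A ([P1])
   or A s ([P2]), and each case accounts for at most [b' - b] edges. *)
have step s : s \in S ->
    (count (fun A => (A \in coset_ball r) (+) (rtrans s A \in coset_ball r)) Q
      <= 2 * (b' - b))%N.
  move=> sS; have sL : s \in letters S by rewrite mem_cat sS.
  have rS t A : t \in letters S -> A \in coset_ball r -> rtrans t A \in coset_ball r.+1.
    move=> tL /(coset_ballP S fN)[x xr <-]; rewrite rtrans_lcoset//; apply/(coset_ballP S fN).
    by exists (x * t)%g => //; rewrite -addn1; apply: word_ballM => //; exact: word_ball_letter.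
  have cr (P : pred (set G)) : (count (fun A => P (rtrans s A)) Q = count P Q)%N.
    rewrite -(count_map (rtrans s)); apply/permP/uniq_perm; last 1 first.
    + move=> A; apply/mapP/idP => [[_ /QP[g ->] ->]|/QP[g ->]].
        by rewrite rtrans_lcoset//; exact: mem_lcosets.
      exists (lcoset (g * s^-1)%g N); first exact: mem_lcosets.
      by rewrite rtrans_lcoset// mulgVK.
    + rewrite map_inj_in_uniq ?fset_uniq// => _ _ /QP[g ->] /QP[k ->].
      rewrite !rtrans_lcoset// => /(congr1 (rtrans s^-1)).
      by rewrite !rtrans_lcoset// !mulgK.
    + exact: fset_uniq.
  pose P1 A := A \in D; pose P2 A := rtrans s A \in D.
  have -> : (2 * (b' - b) = count P1 Q + count P2 Q)%N.
    by rewrite -cD mul2n -addnn /P2 (cr P1) (count_fset DQ).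
  apply: (@leq_trans (count (predU P1 P2) Q)); last by rewrite -count_predUI leq_addr.
  rewrite -(@eq_in_count _ (fun A => (A \in Q) &&
    ((A \in coset_ball r) (+) (rtrans s A \in coset_ball r)))); last by move=> A ->.
  apply: sub_count => A /andP[AQ] /=; rewrite /P1 /P2.
  case: (boolP (A \in coset_ball r)) => Ar /=.
    by move=> sA; rewrite orbC /D in_fsetD sA rS.
  move=> sA; rewrite /D in_fsetD Ar /=; apply/orP; left.
  have := rS _ _ (letters_inv sL) sA.
  by have [g ->] := QP _ AQ; rewrite !rtrans_lcoset// mulgK.
have {}H : eps * (b * (m - b))%:R <= m%:R * (2 * (size S)%:R * (b' - b)%:R).
  apply: le_trans H _; rewrite ler_wpM2l ?ler0n// -!natrM ler_nat.
  rewrite mulnAC -sum1_size big_distrr /= big_seq [leqRHS]big_seq.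
  by apply: leq_sum => s sS; rewrite muln1 step.
have bm : (b <= m)%N by lia.
rewrite natrM !natrB// in H.
have m0R : 0 < m%:R :> R by rewrite ltr0n.
have rmR : 2 * b%:R <= m%:R :> R by rewrite -natrM ler_nat.
have b0R : 0 <= b%:R :> R by rewrite ler0n.
have bbR : b%:R <= b'%:R :> R by rewrite ler_nat.
have s0R : 0 <= (size S)%:R :> R by rewrite ler0n.
have H2 : eps * b%:R <= 4 * (size S)%:R * (b'%:R - b%:R).
  rewrite -(ler_pM2l m0R).
  have : m%:R * b%:R <= 2 * (b%:R * (m%:R - b%:R)) :> R by nra.
  move=> /(ler_wpM2l (ltW eps0)); nra.
rewrite mulrDl mul1r /h -lerBrDl mulrAC ler_pdivrMr; last by lra.
apply: le_trans H2 _; nra.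
Qed.

Lemma ball_growth r : (m < 2 * #|` coset_ball r|)%N \/
  (1 + h) ^+ r <= (#|` coset_ball r|)%:R.
Proof.
have h0 : 0 < h.
  by rewrite divr_gt0// ltr_wpDl// mulr_ge0// ler0n.
elim: r => [|r [IH|IH]].
- right; rewrite expr0 ler1n cardfs_gt0; apply/fset0Pn.
  by exists (lcoset 1 N); apply/(coset_ballP S fN); exists 1%g => //; exact: word_ball1.
- left; apply: leq_trans IH _.
  by rewrite leq_mul2l /=; exact/fsubset_leq_card/coset_ball_subS.
- case: (leqP (2 * #|` coset_ball r|) m) => [/ball_growth_step H|H].
    right; rewrite exprS; apply: le_trans H.
    by rewrite ler_wpM2l// addr_ge0// ltW.
  left; apply: leq_trans H _.
  by rewrite leq_mul2l /=; exact/fsubset_leq_card/coset_ball_subS.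
Qed.

End Growth.

(** * Finiteness of the abelianization *)

Section Index.
Variable G : groupType.
Implicit Types (N M : set G).

Lemma finite_index_trans N M : subgroup N -> subgroup M -> M `<=` N ->
  finite_index N -> finite_set (lcosets N M) ->
  finite_index M /\
  (gindex [set: G] M <= gindex [set: G] N * gindex N M)%N.
Proof.
move=> sN sM MN fN fM.
pose F (A B : set G) : set G := [set (xget 1%g A * b)%g | b in B].
pose QN := fset_set (lcosets [set: G] N); pose QM := fset_set (lcosets N M).
pose s := [seq F A B | A <- QN, B <- QM].
have sub : lcosets [set: G] M `<=` [set` s].
  move=> _ [g _ <-] /=.
  have Ag : lcoset g N g by exists 1%g; rewrite ?mulg1//; exact: subgroup1.
  have [n Nn gn] : lcoset g N (xget 1%g (lcoset g N)) := xgetPex 1%g (ex_intro _ g Ag).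
  have -> : lcoset g M = F (lcoset g N) (lcoset (n^-1)%g M).
    rewrite /F -gn; apply/seteqP; split=> [_ [k Mk <-]|_ [_ [k Mk <-] <-]].
      exists (n^-1 * k)%g; first by exists k.
      by rewrite mulgA mulgK.
    by exists k => //; rewrite mulgA mulgK.
  apply: allpairs_f; first exact: mem_lcosets.
  by rewrite in_fset_set// inE; exists (n^-1)%g => //; exact: subgroupV.
have fM' : finite_index M by exact: sub_finite_set sub (finite_seq _).
split=> //; rewrite /gindex -(size_allpairs F); apply: uniq_leq_size => //.
by move=> A; rewrite in_fset_set// inE => /sub.
Qed.
Lemma expg_mem N M g : subgroup N -> subgroup M -> finite_set (lcosets N M) ->
  N g -> exists2 j, (0 < j <= gindex N M)%N & M (g ^+ j)%g.
Proof.
move=> sN sM fM Ng; set m := gindex N M.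
pose f (i : 'I_m.+1) := lcoset (g ^+ i)%g M.
have /injectivePn[i [i' ii' fE]] : ~~ injectiveb f.
  apply/negP => /injectiveP fi; suff : (m < m)%N by rewrite ltnn.
  rewrite -[X in (X <= _)%N]card_ord cardT -(size_map f).
  apply: uniq_leq_size; first by rewrite map_inj_uniq// enum_uniq.
  move=> _ /mapP[k _ ->]; rewrite in_fset_set// inE; exists (g ^+ k)%g => //.
  exact: subgroupX.
wlog lt : i i' ii' fE / (i < i')%N.
  move=> H; have := ii'; rewrite neq_ltn => /orP[|] lt; first exact: H fE lt.
  by apply: (H i' i) => //; rewrite eq_sym.
exists (i' - i)%N; first by have := ltn_ord i'; lia.
move: fE => /(lcoset_eq _ _ sM).
by rewrite -{1}(subnKC (ltnW lt)) expgnDr mulKg.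
Qed.
End Index.

Section Abelianization.
Variables (G : groupType) (N : set G).

Lemma generated_subgroup (A : set G) : subgroup (generated A).
Proof.
split=> [H [H1 _ _] _|x y Ax Ay H sH AH|x Ax H sH AH] //.
  by apply: subgroupM => //; [exact: Ax|exact: Ay].
by apply: subgroupV => //; exact: Ax.
Qed.

Lemma derived_subgroup : subgroup (derived N).
Proof. exact: generated_subgroup. Qed.

Lemma derived_comm x y : N x -> N y -> derived N [~ x, y]%g.
Proof. by move=> Nx Ny H _; apply; exists x => //; exists y. Qed.

Hypothesis sN : subgroup N.

Lemma derived_sub : derived N `<=` N.
Proof.
move=> x; apply => // _ [y Ny [z Nz <-]].
rewrite commgEl conjgE; apply: (subgroupM sN); first exact: subgroupV.
by apply: (subgroupM sN); [exact: subgroupV|exact: subgroupM].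
Qed.

Lemma derived_normal : normal_subgroup N -> normal_subgroup (derived N).
Proof.
move=> nN; split=> [|g x Dx]; first exact: derived_subgroup.
suff /(_ x Dx) : derived N `<=` [set x | derived N (x ^ g)%g] by [].
have dD := derived_subgroup.
move=> {Dx}x; apply.
  split=> [|y z Dy Dz|y Dy] /=.
  - by rewrite conj1g; exact: (subgroup1 dD).
  - by rewrite conjMg; exact: (subgroupM dD).
  - by rewrite conjVg; exact: (subgroupV dD).
move=> _ [y Ny [z Nz <-]] /=; rewrite conjRg.
by apply: derived_comm; exact: nN.2.
Qed.

Local Notation D := (derived N).

(* The argument sN is what the group structure is inferred from. *)
Definition abelianization of subgroup N := {B : set G | `[< lcosets N D B >]}.
Local Notation ab := (abelianization sN).
HB.instance Definition _ := Choice.on ab.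

Lemma ab_proof : `[< lcosets N D (lcoset 1%g D) >].
Proof. by apply/asboolP; exists 1%g => //; exact: subgroup1. Qed.

Definition ab0 : ab := exist (fun B => `[< lcosets N D B >] : Prop) _ ab_proof.

Definition to_ab (x : G) : ab := insubd ab0 (lcoset x D).

Lemma val_to_ab x : N x -> val (to_ab x) = lcoset x D.
Proof. by move=> Nx; rewrite val_insubd; case: asboolP => // -[]; exists x. Qed.

Lemma ab_ex (a : ab) : exists x, N x /\ to_ab x = a.
Proof.
have /asboolP[x Nx xa] := valP a; exists x; split=> //.
by apply: val_inj; rewrite val_to_ab.
Qed.

Definition ab_repr (a : ab) : G := projT1 (cid (ab_ex a)).

Lemma ab_reprN a : N (ab_repr a).
Proof. by have [] := projT2 (cid (ab_ex a)). Qed.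

Lemma ab_reprK a : to_ab (ab_repr a) = a.
Proof. by have [] := projT2 (cid (ab_ex a)). Qed.

Lemma to_abP x y : N x -> N y -> to_ab x = to_ab y <-> D (x^-1 * y)%g.
Proof.
move=> Nx Ny; rewrite -lcoset_eq; last exact: derived_subgroup.
rewrite -!val_to_ab//; split=> [->//|]; exact: val_inj.
Qed.

Definition ab_add a b := to_ab (ab_repr a * ab_repr b)%g.
Definition ab_opp a := to_ab (ab_repr a)^-1%g.

Lemma derived_normN : forall g x, N g -> D x -> D (x ^ g)%g.
Proof.
move=> g x Ng Dx; have -> : (x ^ g = x * [~ x, g])%g.
  by rewrite commgEl mulgA mulgV mul1g.
apply: (subgroupM derived_subgroup) => //.
by apply: derived_comm => //; exact: derived_sub.
Qed.

Lemma ab_addE x y : N x -> N y -> ab_add (to_ab x) (to_ab y) = to_ab (x * y)%g.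
Proof.
move=> Nx Ny; apply/to_abP; try by apply: subgroupM => //; exact: ab_reprN.
set x' := ab_repr _; set y' := ab_repr _.
have Dx : D (x'^-1 * x)%g by apply/to_abP; rewrite ?ab_reprK//; exact: ab_reprN.
have Dy : D (y'^-1 * y)%g by apply/to_abP; rewrite ?ab_reprK//; exact: ab_reprN.
have -> : ((x' * y')^-1 * (x * y) = (x'^-1 * x) ^ y' * (y'^-1 * y))%g.
  by rewrite invgM conjgE !mulgA mulgK.
apply: (subgroupM derived_subgroup) => //.
by apply: derived_normN => //; exact: ab_reprN.
Qed.

Lemma ab_oppE x : N x -> ab_opp (to_ab x) = to_ab x^-1%g.
Proof.
move=> Nx; have Nx' := ab_reprN (to_ab x); set x' := ab_repr _ in Nx' *.
apply/to_abP; try exact: subgroupV.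
have Dx : D (x^-1 * x')%g by apply/to_abP; rewrite ?ab_reprK.
rewrite invgK; have -> : (x' * x^-1 = (x^-1 * x') ^ x^-1)%g.
  by rewrite conjgE invgK !mulgA mulgV mul1g.
by apply: derived_normN => //; exact: subgroupV.
Qed.

Lemma ab_addA : associative ab_add.
Proof.
move=> a b c; have Na := ab_reprN.
rewrite -(ab_reprK a) -(ab_reprK b) -(ab_reprK c) !ab_addE ?mulgA//;
  by apply: subgroupM.
Qed.

Lemma ab_addC : commutative ab_add.
Proof.
move=> a b; have Na := ab_reprN.
rewrite -(ab_reprK a) -(ab_reprK b) !ab_addE//; apply/to_abP; try exact: subgroupM.
set x := ab_repr a; set y := ab_repr b.
have -> : ((x * y)^-1 * (y * x) = [~ y, x])%g.
  by rewrite invgM commgEl conjgE !mulgA.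
exact: derived_comm (Na b) (Na a).
Qed.

Lemma ab_add0 : left_id ab0 ab_add.
Proof.
have -> : ab0 = to_ab 1%g by apply: val_inj; rewrite val_to_ab//; exact: subgroup1.
by move=> a; rewrite -(ab_reprK a) ab_addE ?mul1g//; [exact: subgroup1|exact: ab_reprN].
Qed.

Lemma ab_addN : left_inverse ab0 ab_opp ab_add.
Proof.
have -> : ab0 = to_ab 1%g by apply: val_inj; rewrite val_to_ab//; exact: subgroup1.
move=> a; have Na := ab_reprN a; rewrite -(ab_reprK a) ab_oppE; last exact: ab_reprN.
by rewrite ab_addE ?mulVg//; apply: (subgroupV sN).
Qed.

HB.instance Definition _ := GRing.isZmodule.Build ab ab_addA ab_addC ab_add0 ab_addN.

Lemma to_abM x y : N x -> N y -> to_ab (x * y)%g = to_ab x + to_ab y.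
Proof. by move=> Nx Ny; rewrite -ab_addE. Qed.

Lemma to_ab1 : to_ab 1%g = 0.
Proof. by apply: val_inj; rewrite val_to_ab//; exact: subgroup1. Qed.

Lemma to_abV x : N x -> to_ab x^-1%g = - to_ab x.
Proof. by move=> Nx; rewrite -ab_oppE. Qed.

Lemma to_abX x n : N x -> to_ab (x ^+ n)%g = to_ab x *+ n.
Proof.
move=> Nx; elim: n => [|n IH]; first exact: to_ab1.
by rewrite expgS to_abM ?IH ?mulrS//; exact: subgroupX.
Qed.

Lemma finite_ab : finite_set [set: ab] -> finite_set (lcosets N D).
Proof.
move=> fA; apply: sub_finite_set (finite_image (fun a : ab => val a) fA).
by move=> _ [x Nx <-]; exists (to_ab x) => //; exact: val_to_ab.
Qed.

End Abelianization.

(* If [a_i *+ q] is twice a multiple of q for every generator, the relations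
   form an integral matrix q (1 - 2 C), whose determinant is nonzero as it is
   odd up to the powers of q; it kills all generators. *)
Lemma finite_zmod (A : zmodType) (J : finType) (a : J -> A) (q : nat) :
  (0 < q)%N -> (forall x : A, exists v : J -> int, x = \sum_j a j *~ v j) ->
  (forall x : A, exists y : A, x *+ q = y *+ (2 * q)) -> finite_set [set: A].
Proof.
move=> q0 gen div.
pose k := #|J|; pose b (i : 'I_k) := a (enum_val i).
have genb x : exists v : 'rV[int]_k, x = \sum_i b i *~ v 0 i.
  have [v ->] := gen x; exists (\row_i v (enum_val i)).
  rewrite (reindex (@enum_val J J)) /=; last exact/onW_bij/enum_val_bij.
  by apply: eq_bigr => i _; rewrite mxE.
have /choice[c cE] : forall i, exists v : 'rV[int]_k,
    b i *+ q = \sum_j b j *~ (2 * q%:Z * v 0 j).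
  move=> i; have [y ->] := div (b i); have [v ->] := genb y; exists v.
  rewrite -sumrMnl; apply: eq_bigr => j _.
  by rewrite pmulrn -mulrzA mulrC PoszM.
pose C : 'M[int]_k := \matrix_(i, j) c i 0 j.
pose B : 'M[int]_k := q%:Z *: (1%:M - C *+ 2).
have rel i : \sum_j b j *~ B i j = 0.
  transitivity (b i *+ q - \sum_j b j *~ (2 * q%:Z * c i 0 j)); last by rewrite cE subrr.
  have -> : b i *+ q = \sum_j b j *~ (q%:Z * (i == j)%:R).
    rewrite (bigD1 i)//= eqxx mulr1 big1 ?addr0// => j; rewrite eq_sym => /negbTE->.
    by rewrite mulr0.
  rewrite -sumrB; apply: eq_bigr => j _; rewrite -mulrzBr; congr (_ *~ _).
  by rewrite !mxE; ring.
have det0 : \det B != 0.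
  rewrite detZ mulf_neq0 ?expf_neq0 ?eqz_nat -?lt0n//.
  apply/eqP => /(congr1 (fun z : int => z%:~R : 'F_2)); apply/eqP.
  rewrite -det_map_mx map_mxB map_mx1 mulr2n map_mxD -mulr2n.
  have -> : map_mx (intr : int -> 'F_2) C *+ 2 = 0.
    by apply/matrixP => i j; rewrite !mxE -mulr2n -mulr_natr pchar_Zp// mulr0.
  by rewrite subr0 det1 oner_eq0.
(* The adjugate of [B] times [B] is the scalar matrix of the determinant, so the relations [rel]
   combine to this one. *)
have kill i : b i *~ \det B = 0.
  have : \sum_j (\sum_l b l *~ B j l) *~ (\adj B i j) = 0.
    by apply: big1 => j _; rewrite rel mul0rz.
  under eq_bigr do rewrite mulrz_suml.
  rewrite exchange_big /= => <-.
  transitivity (\sum_l b l *~ (\adj B *m B) i l).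
    rewrite mul_adj_mx (bigD1 i)//= mxE eqxx mulr1n big1 ?addr0// => l.
    by rewrite mxE eq_sym => /negbTE->.
  apply: eq_bigr => l _; rewrite mxE mulrz_sumr; apply: eq_bigr => j _.
  by rewrite -mulrzA mulrC.
pose d := `|\det B|%N.
have d0 : (0 < d)%N by rewrite absz_gt0.
have killd i : b i *+ d = 0.
  have := kill i; rewrite /d; case: (\det B) => n /=.
    by rewrite -pmulrn.
  by rewrite NegzE mulrNz -pmulrn => /eqP; rewrite oppr_eq0 => /eqP.
have : finite_set (range (fun f : {ffun 'I_k -> 'I_d} => \sum_i b i *+ f i)).
  exact/finite_image/finite_finset.
apply: sub_finite_set => x _; have [v ->] := genb x.
have vd i : (`|(v ord0 i %% d)%Z| < d)%N.
  by rewrite -ltz_nat gez0_abs ?modz_ge0 ?ltz_pmod// eqz_nat -lt0n.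
exists [ffun i => Ordinal (vd i)] => //; apply: eq_bigr => i _; rewrite ffunE /=.
rewrite [in RHS](divz_eq (v 0 i) d) mulrzDr mulrC mulrzA -pmulrn killd mul0rz add0r.
by rewrite -[in RHS](gez0_abs (modz_ge0 _ _)) ?eqz_nat -?lt0n// pmulrn.
Qed.

(** For r = (k + 1) t, Bernoulli's inequality gives [(1 + h) ^+ r >= (h * t) ^+ k.+1], of degree k +
    1 in t, whereas r + 1 <= (k + 2) t makes the left-hand side of degree k in t. *)
Lemma exp_gt_poly (R : realType) (h : R) (n k : nat) : 0 < h ->
  exists r : nat, (n * r.+1 ^ k)%:R < (1 + h) ^+ r.
Proof.
move=> h0.
have bern x t : 0 <= x -> 1 + t%:R * x <= (1 + x) ^+ t :> R.
  move=> x0; elim: t => [|t IH]; first by rewrite mul0r addr0 expr0.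
  rewrite exprS; apply: le_trans (ler_wpM2l _ IH); last by lra.
  rewrite -natr1; have : 0 <= t%:R :> R by []. nra.
pose t := (Num.truncn (n%:R * (k.+2)%:R ^+ k / h ^+ k.+1 : R)).+1.
exists (k.+1 * t)%N.
have t0 : 0 < t%:R :> R by rewrite ltr0n.
have ht : n%:R * (k.+2)%:R ^+ k < h ^+ k.+1 * t%:R.
  rewrite [ltRHS]mulrC -ltr_pdivrMr ?exprn_gt0//; exact: truncnS_gt.
apply: (@le_lt_trans _ _ (n%:R * ((k.+2)%:R * t%:R) ^+ k)).
  rewrite natrM natrX ler_wpM2l ?ler0n// lerXn2r ?nnegrE ?mulr_ge0 ?ler0n//.
  rewrite -natrM ler_nat; lia.
rewrite exprMn mulrA; apply: lt_le_trans (_ : (h * t%:R) ^+ k.+1 <= _).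
  have -> : (h * t%:R) ^+ k.+1 = h ^+ k.+1 * t%:R * t%:R ^+ k.
    by rewrite exprMn -mulrA -exprS.
  by rewrite ltr_pM2r ?exprn_gt0.
rewrite mulnC exprM lerXn2r ?nnegrE ?mulr_ge0 ?exprn_ge0 ?ler0n//; try lra.
by apply: le_trans (bern h t (ltW h0)); lra.
Qed.

(** * Schreier generators and growth modulo the derived subgroup *)

Section Schreier.
Variables (G : groupType) (S : seq G) (N : set G).
Hypotheses (gS : generated [set` S] = [set: G]).
Hypotheses (nN : normal_subgroup N) (fN : finite_index N).
Let sN : subgroup N := nN.1.
Let Q : {fset set G} := fset_set (lcosets [set: G] N).
Local Notation D := (derived N).
Local Notation A := (abelianization sN).

Definition transv (B : set G) : G := xget 1%g B.

Lemma transvP g : N (g * (transv (lcoset g N))^-1)%g.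
Proof.
have : lcoset g N (transv (lcoset g N)).
  by apply: (xgetPex 1%g); exists g; exists 1%g; rewrite ?mulg1//; exact: subgroup1.
move=> [k Nk <-]; rewrite invgM mulgA.
exact: normal_conj nN (subgroupV sN Nk).
Qed.

Let J : finType := (Q * seq_sub (letters S))%type.

Definition schreier (B : set G) (s : G) : G :=
  (transv B * s * (transv (rtrans s B))^-1)%g.

Lemma schreierN B s : B \in Q -> N (schreier B s).
Proof.
rewrite in_fset_set// inE => -[g _ <-]; rewrite /schreier rtrans_lcoset//.
have Ng := transvP g; have := transvP (g * s).
rewrite -[X in N X -> _]mulgA => Ngs.
have -> : (transv (lcoset g N) * s * (transv (lcoset (g * s)%g N))^-1 =
    (g * (transv (lcoset g N))^-1)^-1 * (g * (s * (transv (lcoset (g * s)%g N))^-1)))%g.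
  by rewrite invgM invgK !mulgA mulgVK.
by apply: (subgroupM sN) => //; exact: (subgroupV sN).
Qed.

Let a (j : J) : A := to_ab sN (schreier (val j.1) (val j.2)).

(** A word telescopes into a product of Schreier generators. In the abelianization only their
    multiplicities remain, each at most [r], which is the source of polynomial growth. The constant
    term is there because the chosen representative of [N] need not be 1. *)
Lemma word_abelianized r g : word_ball S r g -> exists c : J -> nat,
  (forall j, (c j <= r)%N) /\
  to_ab sN (g * (transv (lcoset g N))^-1)%g =
    to_ab sN (transv (lcoset 1 N))^-1%g + \sum_j a j *+ c j.
Proof.
move=> [w [+ + <-]] {g}.
elim/last_ind: w r => [|w s IH] r wS sw.
  exists (fun=> 0%N); split=> //.
  by rewrite /= mul1g big1 ?addr0.
case: r sw => [|r]; rewrite size_rcons// ltnS => sw.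
have [|c [cr cE]] := IH r _ sw.
  by move=> x xw; apply: wS; rewrite mem_rcons inE xw orbT.
have sL : s \in letters S by apply: wS; rewrite mem_rcons inE eqxx.
set g := wprod w in cE.
have BQ : lcoset g N \in Q by exact: mem_lcosets.
pose j0 : J := ([` BQ]%fset, SeqSub sL).
exists (fun j => (c j + (j == j0))%N); split.
  by move=> j; rewrite -addn1 leq_add// ?leq_b1.
have -> : wprod (rcons w s) = (g * s)%g.
  by rewrite -cats1 wprod_cat /= mulg1.
have -> : (g * s * (transv (lcoset (g * s)%g N))^-1 =
    g * (transv (lcoset g N))^-1 * schreier (lcoset g N) s)%g.
  by rewrite /schreier rtrans_lcoset// !mulgA mulgVK.
rewrite to_abM//; [|exact: transvP|exact: schreierN].
rewrite cE -addrA; congr (_ + _).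
have -> : to_ab sN (schreier (lcoset g N) s) = \sum_j a j *+ (j == j0).
  by rewrite (bigD1 j0)//= eqxx big1 ?addr0// => j /negbTE->.
by rewrite -big_split; apply: eq_bigr => j _; rewrite mulrnDr.
Qed.

Lemma abelianization_fg (x : A) : exists v : J -> nat, x = \sum_j a j *+ v j.
Proof.
set t := transv (lcoset 1 N).
have Nt : N t.
  by rewrite -(subgroupVE _ sN) -[(t^-1)%g]mul1g; exact: transvP.
have Nx := ab_reprN x.
have [r rx] := generated_word_ball gS (ab_repr x).
have [v [_ vE]] := word_abelianized rx; exists v.
move: vE; rewrite (lcosetN _ sN).2// -/t to_abM ?ab_reprK//; last exact: subgroupV.
by rewrite addrC => /addrI.
Qed.

Section Quotient.
Variable M : set G.
Hypotheses (nM : normal_subgroup M) (DM : D `<=` M) (MN : M `<=` N).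
Hypothesis fM : finite_index M.

(* The Schreier rewriting of a word of length r is a sum of at most r
   generators modulo D, so the balls in G / M grow polynomially. *)
Lemma coset_ball_poly r :
  (#|` coset_ball S M r| <= gindex [set: G] N * r.+1 ^ #|J|)%N.
Proof.
pose F (u : Q * {ffun J -> 'I_r.+1}) : set G :=
  lcoset (ab_repr (to_ab sN (transv (lcoset 1 N))^-1%g + \sum_j a j *+ u.2 j)
          * transv (val u.1))%g M.
have <- : #|(Q * {ffun J -> 'I_r.+1})%type : finType| =
    (gindex [set: G] N * r.+1 ^ #|J|)%N.
  by rewrite card_prod card_ffun card_ord -cardfE.
rewrite cardT -(size_map F); apply: uniq_leq_size => // _ /(coset_ballP S fM)[x xr <-].
have [c [cr cE]] := word_abelianized xr.
have BQ : lcoset x N \in Q by exact: mem_lcosets.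
pose u : Q * {ffun J -> 'I_r.+1} := ([` BQ]%fset, [ffun j => inord (c j)]).
apply/mapP; exists u; rewrite ?mem_enum// /F /=.
have -> : \sum_j a j *+ [ffun j => inord (c j) : 'I_r.+1] j = \sum_j a j *+ c j.
  by apply: eq_bigr => j _; rewrite ffunE inordK// ltnS.
rewrite -cE; set y := ab_repr _; set t := transv _.
apply/(lcoset_eq _ _ nM.1).
have : D ((x * t^-1)^-1 * y)%g.
  apply/(to_abP sN); rewrite ?ab_reprK//; [exact: transvP|exact: ab_reprN].
move=> /DM /(normal_conj (t^-1)%g nM).
by rewrite invgM invgK !mulgA mulVg mul1g.
Qed.

End Quotient.

(* The growth of balls forced by the spectral gap beats the polynomial bound at
   some fixed radius, which bounds by B0 the index of every M with D <= M <= N.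
   For A = N / D and q = B0!, the preimage of 2 q A is such an M, so q kills
   A / 2 q A. *)
Lemma finite_abelianization (R : realType) (eps : R) : 0 < eps ->
  (forall M, normal_subgroup M -> finite_index M -> spectral_gap_ge S M eps) ->
  finite_set (lcosets N D).
Proof.
move=> eps0 gap; apply: (finite_ab (sN := sN)).
pose h := eps / (4 * (size S)%:R + 1).
have h0 : 0 < h.
  by rewrite divr_gt0// ltr_wpDl// mulr_ge0// ler0n.
have [r rP] := exp_gt_poly (gindex [set: G] N) #|J| h0.
pose B0 := (2 * (gindex [set: G] N * r.+1 ^ #|J|))%N.
pose q := B0`!.
have q0 : (0 < q)%N by exact: fact_gt0.
have fg (x : A) : exists v : J -> int, x = \sum_j a j *~ v j.
  have [v ->] := abelianization_fg x.
  by exists (fun j => (v j)%:Z); apply: eq_bigr => j _; rewrite pmulrn.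
apply: (finite_zmod q0 fg) => x.
pose M := [set g | N g /\ exists y, to_ab sN g = y *+ (2 * q)].
have MN : M `<=` N by move=> g [].
have sM : subgroup M.
  split=> [|g g' [Ng [y yE]] [Ng' [y' yE']]|g [Ng [y yE]]].
  - by split; [exact: subgroup1|exists 0; rewrite to_ab1 mul0rn].
  - split; first exact: (subgroupM sN).
    by exists (y + y'); rewrite to_abM// yE yE' mulrnDl.
  - split; first exact: (subgroupV sN).
    exists (- y); apply/eqP; rewrite mulNrn -addr_eq0 -yE -to_abM//; last exact: subgroupV.
    by rewrite mulVg to_ab1.
have nM : normal_subgroup M.
  split=> // g z [Nz [y yE]]; split; first exact: nN.2.
  have Ny := ab_reprN y.
  exists (to_ab sN (ab_repr y ^ g)%g).
  rewrite -to_abX; last exact: nN.2.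
  apply/to_abP; [exact: nN.2|by apply: subgroupX => //; exact: nN.2|].
  rewrite -conjXg -conjVg -conjMg; apply: (derived_normal nN).2.
  by apply/(to_abP sN) => //; [exact: subgroupX|rewrite to_abX// ab_reprK].
have DM : D `<=` M.
  move=> z Dz; have Nz := derived_sub sN Dz; split=> //; exists 0.
  rewrite mul0rn -(to_ab1 sN); apply/to_abP => //; first exact: subgroup1.
  by rewrite mulg1; apply: (subgroupV (derived_subgroup N)).
have q2 : (0 < 2 * q)%N by rewrite muln_gt0.
(* A / 2qA is finite because A is finitely generated: coefficients matter only modulo 2q. *)
have fM : finite_index M.
  apply: (finite_index_trans sN sM MN fN _).1.
  pose F (u : {ffun J -> 'I_(2 * q)}) := lcoset (ab_repr (\sum_j a j *+ u j)) M.
  apply: (@sub_finite_set _ _ (range F)); last exact/finite_image/finite_finset.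
  move=> _ [z Nz <-]; have [v vE] := abelianization_fg (to_ab sN z).
  exists [ffun j => Ordinal (ltn_pmod (v j) q2)] => //.
  apply/(lcoset_eq _ _ sM); set y := \sum_j _; have Ny := ab_reprN y.
  split; first by apply: (subgroupM sN) => //; exact: (subgroupV sN).
  exists (\sum_j a j *+ (v j %/ (2 * q))).
  rewrite to_abM//; last exact: (subgroupV sN).
  rewrite to_abV// ab_reprK vE addrC -sumrB -sumrMnl; apply: eq_bigr => j _.
  by rewrite ffunE /= {1}(divn_eq (v j) (2 * q)) mulrnDr addrK mulrnA.
(* By the choice of [r], the exponential alternative of [ball_growth] contradicts [coset_ball_poly];
   so the ball of radius [r] fills more than half of G / M. *)
have mB : (gindex [set: G] M <= B0)%N.
  have [|/le_lt_trans/(_ _)] := ball_growth nM fM (gap M nM fM) eps0 r.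
    move=> /ltnW /leq_trans; apply; rewrite leq_mul2l /=; exact: coset_ball_poly.
  move=> H; suff /H : (#|` coset_ball S M r|)%:R < (1 + h) ^+ r by rewrite ltxx.
  by apply: le_lt_trans rP; rewrite ler_nat; exact: coset_ball_poly.
pose g := ab_repr x; have Ng : N g by exact: ab_reprN.
(* Some positive power of g with exponent at most [B0] lies in [M], and that exponent divides [q],
   the factorial of [B0]. *)
have [j /andP[j0 jM] gj] : exists2 j, (0 < j <= gindex [set: G] M)%N & M (g ^+ j)%g.
  by apply: expg_mem.
have [_ [y yE]] : M (g ^+ q)%g.
  have /dvdnP[t ->] : (j %| q)%N by rewrite dvdn_fact// j0 (leq_trans jM).
  by rewrite mulnC expgnA; exact: subgroupX.
by exists y; rewrite -yE to_abX// ab_reprK.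
Qed.

End Schreier.

(** * Chains, fillings and the rank of the 2-cycles *)

Section ChainNorm.
Variable K : choiceType.
Implicit Types (A B : chain K) (s : seq K).

Lemma chain_normE A s : uniq s -> {subset dom A <= s} ->
  chain_norm A = (\sum_(x <- s) `|coeff x A|)%N.
Proof.
move=> us ds; rewrite [RHS](bigID [in dom A]) /=.
rewrite [X in (_ + X)%N]big1 ?addn0; last by move=> x; rewrite mem_dom negbK => /eqP->.
rewrite -big_filter; apply: perm_big; apply: uniq_perm.
- exact: uniq_dom.
- exact: filter_uniq.
- by move=> x; rewrite mem_filter; case: (boolP (x \in dom A)) => // /ds->.
Qed.

Lemma chain_norm0 : chain_norm (0 : chain K) = 0%N.
Proof. by rewrite /chain_norm dom0 big_nil. Qed.

Lemma chain_normN A : chain_norm (- A) = chain_norm A.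
Proof.
rewrite (@chain_normE (- A) (dom A)) ?uniq_dom//; last by move=> x; rewrite domN.
by apply: eq_bigr => x _; rewrite coeffN abszN.
Qed.

Lemma chain_normD A B : (chain_norm (A + B)%R <= chain_norm A + chain_norm B)%N.
Proof.
pose s := undup (dom A ++ dom B).
have us : uniq s by exact: undup_uniq.
rewrite (chain_normE us) => [|x /domD_subset]; last by rewrite mem_undup.
rewrite (@chain_normE A s)//; last by move=> x; rewrite mem_undup mem_cat => ->.
rewrite (@chain_normE B s)//; last by move=> x; rewrite mem_undup mem_cat orbC => ->.
by rewrite -big_split; apply: leq_sum => x _; rewrite coeffD /=; lia.
Qed.

Lemma chain_norm_sum (I : Type) (r : seq I) (P : pred I) (F : I -> chain K) :
  (chain_norm (\sum_(i <- r | P i) F i)%R <= \sum_(i <- r | P i) chain_norm (F i))%N.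
Proof.
elim/big_ind2: _ => [|A m B n An Bm|//]; first by rewrite chain_norm0.
by apply: leq_trans (chain_normD _ _) _; exact: leq_add.
Qed.

Lemma chain_normU (x : K) : chain_norm << x >> = 1%N.
Proof. by rewrite /chain_norm domU1 big_seq1 coeffU eqxx mulr1. Qed.

Lemma chain_norm_eq0 A : chain_norm A = 0%N -> A = 0.
Proof.
move=> /eqP; rewrite sum_nat_seq_eq0 => /allP A0.
apply/eqP/freeg_eqP => x; rewrite coeff0.
have [xA|/coeff_outdom//] := boolP (x \in dom A).
by have := A0 x xA; rewrite /= absz_eq0 => /eqP.
Qed.

Lemma chain_sumE A s : uniq s -> {subset dom A <= s} ->
  A = \sum_(x <- s) << x >> *~ coeff x A.
Proof.
move=> us ds; apply/eqP/freeg_eqP => y; rewrite raddf_sum /=.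
under eq_bigr do rewrite raddfMz /= coeffU mul1r.
have [ys|ys] := boolP (y \in s).
  rewrite (bigD1_seq y)//= eqxx big1 ?addr0 ?intz// => x /negbTE->.
  by rewrite mul0rz.
rewrite coeff_outdom; last by apply: contra ys; exact: ds.
rewrite big_seq big1// => x xs; case: eqVneq => [xy|_]; last by rewrite mul0rz.
by rewrite -xy xs in ys.
Qed.

End ChainNorm.

HB.instance Definition _ (K : choiceType) (M : lmodType int) (f : K -> M) :=
  GRing.isAdditive.Build (chain K) M (fglift f) (lift_is_additive f).

Section Fill.
Variables (X : complex2) (R : realType).
Implicit Types (A B : chain (face X)) (z : chain (edge X)).

Lemma bdry2_is_additive : additive (@bdry2 X).
Proof. exact: lift_is_additive. Qed.

HB.instance Definition _ := GRing.isAdditive.Build _ _ (@bdry2 X) bdry2_is_additive.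

Lemma bdry2U (f : face X) : bdry2 << f >> = bdry_face f.
Proof. by rewrite /bdry2 liftU scale1r. Qed.

(** Norms are natural numbers, so the infimum defining [fill1] is attained. *)
Lemma min_filling z : boundaries1 z ->
  exists2 A, bdry2 A = z & fill1 R z = (chain_norm A)%:R.
Proof.
move=> [A0 _ A0z].
have ex : exists n, `[< exists2 A, bdry2 A = z & chain_norm A = n >].
  by exists (chain_norm A0); apply/asboolP; exists A0.
case: (ex_minnP ex) => n /asboolP[A Az An] nmin; exists A => //.
rewrite /fill1; apply/eqP; rewrite eq_le; apply/andP; split.
  apply: ge_inf; last by exists A.
  by exists 0 => _ [B _ <-]; rewrite ler0n.
apply: lb_le_inf; first by exists (chain_norm A)%:R; exists A.
move=> _ [B Bz <-]; rewrite ler_nat An; apply: nmin.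
by apply/asboolP; exists B.
Qed.

(** Used with [x] equal to C times xi_2 and [n] the index. The product form avoids dividing by
    [rho1], which is +oo when all boundaries vanish. *)
Lemma short_filling (n : nat) (x : R) : 0 <= x ->
  (n%:R%:E <= x%:E * rho1 X R)%E -> forall z, boundaries1 z ->
  exists2 A, bdry2 A = z & (chain_norm A)%:R * n%:R <= x * (chain_norm z)%:R.
Proof.
move=> x0 nx z Bz; have [->|z0] := eqVneq z 0.
  by exists 0; rewrite ?raddf0// chain_norm0 mul0r mulr_ge0.
have [A Az fA] := min_filling Bz; exists A => //.
have A0 : 0 < (chain_norm A)%:R :> R.
  rewrite ltr0n lt0n; apply: contra_neq z0 => /chain_norm_eq0 A0.
  by rewrite -Az A0 raddf0.
have : (rho1 X R <= ((chain_norm z)%:R / fill1 R z)%:E)%E.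
  by apply: ereal_inf_lbound; exists z => //; split=> //; exact/eqP.
move=> rz; have x0E : (0 <= x%:E)%E by rewrite lee_fin.
have := le_trans nx (lee_wpmul2l x0E rz).
by rewrite -EFinM lee_fin fA mulrA ler_pdivlMr// mulrC.
Qed.

End Fill.

Section Rank.
Variable V : zmodType.
Implicit Types A B : set V.

Lemma zfree_widen b n (le_bn : (b <= n)%N) (S : 'I_n -> V) : zfree S ->
  zfree (fun i : 'I_b => S (widen_ord le_bn i)).
Proof.
move=> fS a a0 j; pose a' (i : 'I_n) : int := oapp a 0 (insub (i : nat)).
have a'E i : a' (widen_ord le_bn i) = a i.
  by rewrite /a' /= insubT//= => lt; congr a; exact: val_inj.
rewrite -a'E; apply: fS; rewrite -[RHS]a0 /zcomb (bigID (fun i : 'I_n => (i < b)%N)) /=.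
rewrite [X in _ + X]big1 ?addr0; last first.
  by move=> i ib; rewrite /a' insubF ?mulr0z//; exact/negbTE.
by rewrite (big_ord_narrow le_bn); apply: eq_bigr => i _; rewrite a'E.
Qed.

Lemma has_rank_uniq A m n : has_rank A m -> has_rank A n -> m = n.
Proof.
wlog: m n / (m <= n)%N => [H Hm Hn|mn [_ Hm] [[S SA fS] _]].
  by have [mn|/ltnW nm] := leqP m n; [exact: H|apply/esym/H].
apply/eqP; rewrite eqn_leq mn leqNgt; apply/negP => lt; apply: Hm.
by exists (fun i => S (widen_ord lt i)) => //; exact: zfree_widen.
Qed.

Lemma zrankE A n : has_rank A n -> zrank A = n.
Proof.
move=> An; apply: xget_unique => // m Am; exact: has_rank_uniq Am An.
Qed.

Lemma zrank_neq0 A : zrank A != 0%N -> has_rank A (zrank A).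
Proof.
rewrite /zrank; case: xgetP => [n _ //|_]; by rewrite eqxx.
Qed.

End Rank.

(** A rational relation between the rows, multiplied by the product of all denominators. *)
Lemma row_kernel_int n m (M : 'M[rat]_(n, m)) : ~~ row_free M ->
  exists2 a : 'I_n -> int, (exists j, a j != 0) &
    forall k, \sum_j (a j)%:~R * M j k = 0.
Proof.
rewrite -kermx_eq0 => /rowV0Pn[u /sub_kermxP uM /rV0Pn[j0 uj0]].
pose d : int := \prod_j denq (u 0 j).
pose a j : int := numq (u 0 j) * \prod_(i | i != j) denq (u 0 i).
have aE j : (a j)%:~R = u 0 j * d%:~R.
  by rewrite /a /d [in RHS](bigD1 j)//= !rmorphM /= numqE mulrA.
have d0 : d%:~R != 0 :> rat.
  by rewrite intr_eq0; apply/prodf_neq0 => j _; exact: denq_neq0.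
exists a; first by exists j0; rewrite -(intr_eq0 rat) aE mulf_neq0.
move=> k; under eq_bigr do rewrite aE mulrAC.
rewrite -mulr_suml; have := congr1 (fun v : 'rV_m => v 0 k) uM.
by rewrite !mxE => ->; rewrite mul0r.
Qed.

(** The last hypothesis says that the [U j] span the 2-cycles over the rationals, so [b] independent
    ones can be picked among them; these compete in the infimum defining [xi2]. *)
Lemma xi2_le (X : complex2) (R : realType) (J : finType)
    (U : J -> chain (face X)) (T : nat) (c : R) :
  finite_set [set: face X] -> (0 < T)%N -> 0 <= c ->
  (forall j, cycles2 (U j)) -> (forall j, (chain_norm (U j))%:R <= c) ->
  (forall A, cycles2 A -> exists v : J -> int, A *+ T = \sum_j U j *~ v j) ->
  xi2 X R <= c.
Proof.
move=> finF T0 c0 Ucyc Uc Uspan; rewrite /xi2; case: eqP => // /eqP b0.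
have [[S0 S0cyc S0free] nofree] := zrank_neq0 b0.
set b := zrank _ in b0 S0 S0cyc S0free nofree *.
pose fs : seq (face X) := fset_set [set: face X].
have fsP f : f \in fs by rewrite in_fset_set// inE.
(* Coordinates in the finitely many 2-cells: [free_mat] and [mat_free] translate independence over
   the integers into independence of rational rows, where division by [T] is possible. *)
pose row_of (A : chain (face X)) : 'rV[rat]_(size fs) :=
  \row_k (coeff (tnth (in_tuple fs) k) A)%:~R.
have row_inj A : (forall k, row_of A 0 k = 0) -> A = 0.
  move=> A0; apply/eqP/freeg_eqP => f; rewrite coeff0.
  have /tnthP[k ->] : f \in in_tuple fs by [].
  by have := A0 k; rewrite mxE => /eqP; rewrite intr_eq0 => /eqP.
have row_comb n (S : 'I_n -> chain (face X)) (a : 'I_n -> int) k :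
    row_of (zcomb S a) 0 k = \sum_j (a j)%:~R * row_of (S j) 0 k.
  rewrite mxE /zcomb raddf_sum rmorph_sum; apply: eq_bigr => j _.
  by rewrite mxE raddfMz raddfMz /= -mulrzl.
pose mat n (S : 'I_n -> chain (face X)) := \matrix_(j < n) row_of (S j).
have free_mat n (S : 'I_n -> chain (face X)) : zfree S -> row_free (mat n S).
  move=> fS; apply: contrapT => /negP /row_kernel_int[a [j aj] ak].
  move: aj; rewrite fS ?eqxx//; apply: row_inj => k; rewrite row_comb -[RHS](ak k).
  by apply: eq_bigr => i _; rewrite /mat mxE.
have mat_free n (S : 'I_n -> chain (face X)) : row_free (mat n S) -> zfree S.
  move=> fS a a0 j; pose u : 'rV[rat]_n := \row_i (a i)%:~R.
  have : u *m mat n S = 0 *m mat n S.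
    apply/rowP => k; rewrite mul0mx [RHS]mxE mxE.
    transitivity (row_of (zcomb S a) 0 k); last by rewrite a0 mxE raddf0.
    by rewrite row_comb; apply: eq_bigr => i _; rewrite /mat !mxE.
  move/(row_free_inj fS)/rowP/(_ j); rewrite !mxE => /eqP.
  by rewrite intr_eq0 => /eqP.
pose U' (i : 'I_#|J|) := U (enum_val i).
have sub : (mat b S0 <= mat _ U')%MS.
  apply/row_subP => j; rewrite rowK.
  have [v vE] := Uspan _ (S0cyc j).
  pose w : 'rV[rat]_#|J| := \row_i ((v (enum_val i))%:~R / T%:R).
  apply/submxP; exists w; apply/rowP => k; rewrite [RHS]mxE.
  have TT : T%:R != 0 :> rat by rewrite pnatr_eq0 -lt0n.
  apply: (mulIf TT); rewrite mulr_suml.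
  transitivity (row_of (S0 j *+ T) 0 k); first by rewrite !mxE raddfMn rmorphMn /= mulr_natr.
  rewrite vE (reindex (@enum_val J J)) /=; last exact/onW_bij/enum_val_bij.
  rewrite -/(zcomb U' (fun i => v (enum_val i))) row_comb; apply: eq_bigr => i _.
  by rewrite !mxE mulrAC divfK.
have br : (b <= \rank (mat _ U'))%N.
  by have /eqP <- := free_mat _ _ S0free; exact: mxrankS.
(* Selects rows of [U'] forming a basis of the row space; its rank is at least [b] by [br], and the
   first [b] of them are kept. *)
pose f := maxrankfun (mat _ U').
have rf : row_free (mat _ (U' \o f)).
  have -> : mat _ (U' \o f) = rowsub f (mat _ U').
    by apply/matrixP => i k; rewrite !mxE.
  exact: maxrowsub_free.
pose S := (fun i : 'I_b => U' (f (widen_ord br i))).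
have Sfree : zfree S by exact: (zfree_widen (le_bn := br) (mat_free _ _ rf)).
have Scyc j : cycles2 (S j) by exact: Ucyc.
have comb_cyc (a : 'I_b -> int) : cycles2 (zcomb S a).
  rewrite /cycles2 /= /zcomb raddf_sum big1// => j _.
  by rewrite raddfMz /= Scyc mul0rz.
have Srank : zrank (zspan S) = b.
  apply: zrankE; split.
    exists S => // j; exists (fun i => (i == j)%:Z) => //.
    rewrite /zcomb (bigD1 j)//= eqxx mulr1z big1 ?addr0// => i /negbTE->.
    by rewrite mulr0z.
  move=> [S' S'S S'free]; apply: nofree; exists S' => // j.
  by have [a _ <-] := S'S j; exact: comb_cyc.
apply: (@le_trans _ _ (\max_(j < b) chain_norm (S j))%:R).
  apply: ge_inf; last by exists S.
  by exists 0 => _ [? _ <-]; rewrite ler0n.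
elim/big_ind: _ => // [m n mc nc|j _]; last exact: Uc.
by rewrite /maxn; case: ifP.
Qed.

(** * Lifting paths to covers *)

Section Lift.
Variables (X : complex2) (x0 : vert X).
Local Notation pclass := (pclass x0).
Local Notation U := (universal_cover x0).
Local Notation c0 := (pi1_one x0 : pclass).
Implicit Types (c : pclass) (d : dart X) (p q : seq (dart X)) (g h k : pi1 x0).

Lemma cend_c0 : cend c0 = x0. Proof. exact: pendg. Qed.

Lemma act_c0 g : act g c0 = g.
Proof. exact: (congr1 (@loopc _ _) (pi1_mulg1 g)). Qed.

Lemma actgM g h c : act (g * h)%g c = act g (act h c).
Proof. exact: actM. Qed.

Lemma actg1 c : act 1%g c = c.
Proof. exact: act1. Qed.

Lemma ext_c0 (u : epath x0) : ext c0 (val u) = pi_ u.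
Proof. exact: ext_one. Qed.

(** Following a path of [c] backwards carries the fixed vertex to the base vertex, on which [g] acts
    by giving [g] itself. *)
Lemma act_free g c : act g c = c -> g = 1%g.
Proof.
move=> gc; apply/val_inj; pose u := repr c.
have cE : ext c0 (val u) = c by rewrite ext_c0 pi_repr.
have wu : walk (cend c0) (val u) by rewrite cend_c0; exact: valP.
have cp : ext c (pinv (val u)) = c0 by rewrite -cE ext_pinv.
have wp : walk (cend c) (pinv (val u)).
  by rewrite -cE cend_ext//; have [] := walk_pinv wu.
transitivity (act g c0); first by rewrite act_c0.
by rewrite -[X in act g X]cp act_ext// gc cp.
Qed.

Lemma walk_step c d : dsrc d = cend c -> walk (cend c) [:: d].
Proof. by move=> /= ->; rewrite eqxx. Qed.

Lemma cend_step c d : dsrc d = cend c -> cend (ext c [:: d]) = dtgt d.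
Proof. by move=> dc; rewrite cend_ext ?walk_step. Qed.

Lemma ext_cons c d p : walk (cend c) (d :: p) ->
  ext c (d :: p) = ext (ext c [:: d]) p.
Proof. by rewrite -cat1s => /ext_cat. Qed.

Lemma udart_act g c d : dsrc d = cend c ->
  udart (act g c) d = omap (fun u : dart U => (uact g u.1, u.2) : dart U) (udart c d).
Proof.
move=> dc; have [u uE _] := udartP dc; move: uE.
rewrite /udart; case: insubP => //= e eE eval _.
set c' := if d.2 then c else _ in eE eval *.
have -> : (if d.2 then act g c else ext (act g c) [:: d]) = act g c'.
  by rewrite /c'; case: ifP => // _; rewrite act_ext// walk_step.
case: insubP => [e' _ e'val|]; last by rewrite /= cend_act eE.
by congr (Some (_, _)); apply: val_inj; rewrite e'val /= eval.
Qed.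

Lemma uactM (K : choiceType) (h : K -> vert X) (g g' : pi1 x0) (e : ulift x0 h) :
  uact (g * g')%g e = uact g (uact g' e).
Proof. by apply: val_inj; rewrite /= actgM. Qed.

Lemma uact1 (K : choiceType) (h : K -> vert X) (e : ulift x0 h) : uact 1%g e = e.
Proof. by apply: val_inj; rewrite /= actg1; case: (val e). Qed.

Lemma ulift_path_mem c q u : walk (cend c) q -> u \in ulift_path c q ->
  exists p2 d p3, [/\ q = p2 ++ d :: p3, dsrc d = cend (ext c p2) &
    udart (ext c p2) d = Some u].
Proof.
elim: q c => [//|d q IH] c; move=> w; have /= /andP[/eqP dc wq] := w.
have [v vE _] := udartP dc; rewrite vE inE => /orP[/eqP->|].
  by exists [::], d, q; rewrite ext_nil.
have wq' : walk (cend (ext c [:: d])) q by rewrite cend_step.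
move=> /(IH _ wq')[p2 [d' [p3 [qE sd ud]]]]; exists (d :: p2), d', p3.
have w2 : walk (cend c) (d :: p2).
  by move: w; rewrite qE -cat_cons walk_cat => /andP[].
by rewrite qE ext_cons.
Qed.

Section Orbit.
Variables (N : set (pi1 x0)) (sN : subgroup N).

Lemma orbit_eqP (T : choiceType) (a : pi1 x0 -> T -> T) (x y : T) :
  (forall z, a 1%g z = z) -> (forall g h z, a (g * h)%g z = a g (a h z)) ->
  to_orbit N a x = to_orbit N a y <-> exists2 g, N g & y = a g x.
Proof.
move=> a1 aM; split=> [/(congr1 val)/= E|[g Ng ->]].
  have : orbit N a y y by exists 1%g; rewrite ?a1//; exact: subgroup1.
  by rewrite -E => -[g Ng <-]; exists g.
apply: val_inj => /=; apply/seteqP; split=> _ [h Nh <-].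
  exists (h * g^-1)%g; first by apply: subgroupM => //; exact: subgroupV.
  by rewrite -aM mulgVK.
by exists (h * g)%g; rewrite ?aM//; exact: subgroupM.
Qed.

Lemma qe_act g (e : edge U) : N g -> qe N (uact g e) = qe N e.
Proof.
move=> Ng; apply/esym/orbit_eqP; [exact: uact1|exact: uactM|by exists g].
Qed.

Definition dart_chain (u : dart U) : chain (edge (cover N)) :=
  if u.2 then << qe N u.1 >> else - << qe N u.1 >>.

(** Chains of the cover are computed on the universal cover, where a path of X has one lift from
    [c]; only the resulting chain is projected. *)
Definition lift_chain c p : chain (edge (cover N)) :=
  \sum_(u <- ulift_path c p) dart_chain u.

Lemma lift_chain_nil c : lift_chain c [::] = 0.
Proof. exact: big_nil. Qed.

Lemma lift_chain1 c d u : udart c d = Some u -> lift_chain c [:: d] = dart_chain u.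
Proof. by rewrite /lift_chain /= => ->; rewrite big_seq1. Qed.

Lemma lift_chain_cons c d p : dsrc d = cend c ->
  lift_chain c (d :: p) = lift_chain c [:: d] + lift_chain (ext c [:: d]) p.
Proof.
move=> dc; have [u uE _] := udartP dc.
by rewrite (lift_chain1 uE) /lift_chain /= uE big_cons.
Qed.

Lemma lift_chain_cat c p q : walk (cend c) p ->
  lift_chain c (p ++ q) = lift_chain c p + lift_chain (ext c p) q.
Proof.
elim: p c => [|d p IH] c w; first by rewrite lift_chain_nil add0r ext_nil.
have /= /andP[/eqP dc wp] := w.
rewrite lift_chain_cons// [in RHS]lift_chain_cons// (ext_cons w) IH ?addrA//.
by rewrite cend_step.
Qed.

Lemma lift_chain_act g c p : N g -> walk (cend c) p ->
  lift_chain (act g c) p = lift_chain c p.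
Proof.
move=> Ng; elim: p c => [|d p IH] c w; first by rewrite !lift_chain_nil.
have /= /andP[/eqP dc wp] := w.
rewrite lift_chain_cons ?cend_act// [RHS]lift_chain_cons//.
rewrite -act_ext ?walk_step// IH ?cend_step//; congr (_ + _).
have [u uE _] := udartP dc.
rewrite (lift_chain1 uE) (lift_chain1 (u := (uact g u.1, u.2))); last first.
  by rewrite udart_act// uE.
by rewrite /dart_chain /= qe_act.
Qed.

Lemma lift_chain_dinv c d : dsrc d = cend c ->
  lift_chain (ext c [:: d]) [:: dinv d] = - lift_chain c [:: d].
Proof.
move=> dc; have [u uE _] := udartP dc; rewrite (lift_chain1 uE).
have E : ext (ext c [:: d]) [:: dinv d] = c.
  by apply: (ext_pinv (p := [:: d])); exact: walk_step.
have uE' : udart (ext c [:: d]) (dinv d) = Some (u.1, ~~ u.2).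
  move: uE; rewrite /udart; case: d dc E => e [] dc E /=; rewrite ?E;
  by case: insubP => //= v _ _ [<-].
by rewrite (lift_chain1 uE') /dart_chain /=; case: u.2; rewrite ?opprK.
Qed.

Lemma lift_chain_pinv c p : walk (cend c) p ->
  lift_chain (ext c p) (pinv p) = - lift_chain c p.
Proof.
elim: p c => [|d p IH] c w; first by rewrite ext_nil !lift_chain_nil oppr0.
have /= /andP[/eqP dc wp] := w.
have wp' : walk (cend (ext c [:: d])) p by rewrite cend_step.
rewrite pinv_cons lift_chain_cat; last first.
  by rewrite cend_ext//; have [] := walk_pinv w; rewrite pinv_cons walk_cat => /andP[].
rewrite (ext_cons w) IH// ext_pinv// lift_chain_dinv//.
by rewrite [in RHS]lift_chain_cons// opprD addrC.
Qed.

Lemma size_ulift_path c p : walk (cend c) p -> size (ulift_path c p) = size p.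
Proof. by move=> /ulift_pathP[E _ _]; rewrite -[in RHS]E size_map. Qed.

Lemma chain_norm_lift c p : walk (cend c) p ->
  (chain_norm (lift_chain c p) <= size p)%N.
Proof.
move=> w; apply: leq_trans (chain_norm_sum _ _ _) _.
rewrite -(size_ulift_path w) -sum1_size; apply: leq_sum => u _.
by rewrite /dart_chain; case: u.2; rewrite ?chain_normN chain_normU.
Qed.

Definition qf (f : face U) : face (cover N) := to_orbit N _ f.

(** The attaching loop of a 2-cell of the cover comes from an arbitrarily chosen lift; as chains are
    invariant under [N], any lift [f] serves. *)
Lemma bdry_qf (f : uface x0) :
  bdry_face (qf f) = lift_chain (val f).1 (bdry (val f).2).
Proof.
have [g Ng fE] := (orbit_eqP f (orbit_repr (qf f)) (@uact1 _ _)
  (@uactM _ _)).1 (esym (orbit_reprK (qf f))).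
rewrite /bdry_face /= /qbdry big_map fE /=.
rewrite -(@lift_chain_act g) ?uface_walk//.
Qed.

Lemma boundaries1_0 : @boundaries1 (cover N) 0.
Proof. by exists 0 => //; exact: raddf0. Qed.

Lemma boundaries1D z w : @boundaries1 (cover N) z -> @boundaries1 (cover N) w ->
  @boundaries1 (cover N) (z + w).
Proof. by move=> [A _ <-] [B _ <-]; exists (A + B) => //; exact: raddfD. Qed.

Lemma boundaries1N z : @boundaries1 (cover N) z -> @boundaries1 (cover N) (- z).
Proof. by move=> [A _ <-]; exists (- A) => //; exact: raddfN. Qed.

Lemma boundaries1_bdry c f : cend c = base f ->
  @boundaries1 (cover N) (lift_chain c (bdry f)).
Proof.
move=> /eqP cf; pose F : uface x0 := exist _ (c, f) cf.
by exists << qf F >> => //; rewrite bdry2U bdry_qf.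
Qed.

(** A backtrack contributes two opposite terms, and a cell move the boundary of one 2-cell of the
    cover. *)
Lemma lift_chain_elementary c p q : elementary p q ->
  walk (cend c) p -> walk (cend c) q ->
  @boundaries1 (cover N) (lift_chain c p - lift_chain c q).
Proof.
case=> {p q} [p d q|p f q].
  rewrite walk_cat /= => /and3P[wp /eqP dp /andP[_ wq]] _.
  have dp' : dsrc d = cend (ext c p) by rewrite cend_ext.
  rewrite !lift_chain_cat// lift_chain_cons//.
  rewrite [lift_chain _ (dinv d :: q)]lift_chain_cons ?cend_step ?dsrc_inv//.
  rewrite lift_chain_dinv// (ext_pinv (p := [:: d])) ?walk_step//.
  rewrite addNKr subrr; exact: boundaries1_0.
rewrite !walk_cat => /and3P[wp wb _] /andP[_ wq].
have fp : wend (cend c) p = base f.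
  have := bdry_walk f; have := bdry_neq0 f.
  by case: (bdry f) wb => //= d b /andP[/eqP-> _] _ /andP[/eqP].
have fp' : cend (ext c p) = base f by rewrite cend_ext.
rewrite lift_chain_cat// lift_chain_cat ?cend_ext// [in X in _ - X]lift_chain_cat//.
rewrite ext_bdry// opprD addrACA subrr add0r addrK; exact: boundaries1_bdry.
Qed.

Lemma lift_chain_homotopic (u v : epath x0) : homotopic u v ->
  @boundaries1 (cover N) (lift_chain c0 (val u) - lift_chain c0 (val v)).
Proof.
have w (t : epath x0) : walk (cend c0) (val t) by rewrite cend_c0; exact: valP.
elim=> {u v} [u v uv|u|u v _ IH|u v t _ IH1 _ IH2].
- exact: lift_chain_elementary.
- rewrite subrr; exact: boundaries1_0.
- by rewrite -opprB; exact: boundaries1N.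
- by rewrite -(subrKA (lift_chain c0 (val v))); exact: boundaries1D.
Qed.

Definition loop_chain g := lift_chain c0 (val (repr (g : pclass))).

Lemma lift_chain_loop (u : epath x0) g : pi_ u = g ->
  @boundaries1 (cover N) (lift_chain c0 (val u) - loop_chain g).
Proof. by move=> ug; apply: lift_chain_homotopic; apply/pi_P; rewrite pi_repr. Qed.

(** As [g] is in [N], the lifts of [h] from [g] and from the base vertex have the same image. So
    modulo boundaries [loop_chain] is the Hurewicz map on [N]. *)
Lemma loop_chainM g h : N g ->
  @boundaries1 (cover N) (loop_chain (g * h)%g - (loop_chain g + loop_chain h)).
Proof.
move=> Ng; pose u := repr (g : pclass); pose v := repr (h : pclass).
have ug : pend u = x0 by rewrite -/(cend _) pendg.
have wv : walk (pend u) (val v) by rewrite ug; exact: valP.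
have uv : val (pcat u (val v)) = val u ++ val v by exact: val_pcat.
have E : pi_ (pcat u (val v)) = (g * h)%g by [].
rewrite -opprB; apply: boundaries1N.
have := lift_chain_loop E; rewrite uv lift_chain_cat; last first.
  by rewrite cend_c0; exact: valP.
rewrite ext_c0 pi_repr; suff -> : lift_chain g (val v) = lift_chain c0 (val v) by [].
by rewrite -{1}[loopc g]act_c0 lift_chain_act// cend_c0; exact: valP.
Qed.

(** Modulo boundaries [loop_chain] is a homomorphism from [N] to an abelian group, hence kills
    commutators. *)
Lemma derived_boundary g : derived N g -> @boundaries1 (cover N) (loop_chain g).
Proof.
pose B z := @boundaries1 (cover N) z.
have BD z w : B z -> B (z - w) -> B w.
  move=> Bz Bzw; have -> : w = z - (z - w) by rewrite subKr.
  by apply: boundaries1D => //; exact: boundaries1N.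
have BD' z w : B w -> B (z - w) -> B z.
  by move=> Bz Bzw; rewrite -(subrK w z); exact: boundaries1D.
have BA y z w : B (z - w) -> B (y + w) -> B (y + z).
  move=> Bzw Byw; have -> : y + z = (y + w) + (z - w) by rewrite -addrA subrKC.
  exact: boundaries1D.
have B1 : B (loop_chain 1%g).
  have := loop_chainM 1%g (subgroup1 sN); rewrite mul1g opprD addrA subrr sub0r.
  by move=> /boundaries1N; rewrite opprK.
have BV h : N h -> B (loop_chain h + loop_chain h^-1%g).
  by move=> Nh; have := loop_chainM h^-1%g Nh; rewrite mulgV; exact: BD.
move=> Dg; suff [] : N g /\ B (loop_chain g) by [].
apply: (Dg [set g | N g /\ B (loop_chain g)]) => {g Dg}.
  split=> [|g h [Ng Bg] [Nh Bh]|g [Ng Bg]].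
  - by split=> //; exact: subgroup1.
  - split; first exact: subgroupM.
    by apply: BD' (loop_chainM h Ng); exact: boundaries1D.
  - split; first exact: subgroupV.
    apply: (BD' _ (loop_chain g + loop_chain g^-1%g)); first exact: BV.
    rewrite opprD [X in B (_ + X)]addrC addrA subrr sub0r; exact: boundaries1N.
move=> _ [g Ng [h Nh <-]]; rewrite commgEl conjgE /=.
have NV : N g^-1%g /\ N h^-1%g by split; exact: subgroupV.
have Ngh : N (g * h)%g by exact: subgroupM.
split; first by do !apply: (subgroupM sN) => //; tauto.
apply: BD' (loop_chainM _ NV.1).
apply: (BA _ _ _ (loop_chainM _ NV.2)); rewrite addrA; apply: (BA _ _ _ (loop_chainM h Ng)).
rewrite addrACA [loop_chain g^-1%g + _]addrC [loop_chain h^-1%g + _]addrC.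
by apply: boundaries1D; exact: BV.
Qed.

End Orbit.
End Lift.

(** * Covers whose closed paths are null as chains *)

Section Degenerate.
Variables (X : complex2) (x0 : vert X) (N : set (pi1 x0)).
Local Notation pclass := (pclass x0).
Local Notation U := (universal_cover x0).
Hypothesis sN : subgroup N.

Lemma coeff_dart_chain (u v : dart U) : qe N v.1 = qe N u.1 ->
  coeff (qe N u.1) (dart_chain N v) = if v.2 then 1 else -1.
Proof.
by move=> e; rewrite /dart_chain; case: v.2; rewrite ?coeffN coeffU e eqxx mulr1.
Qed.

Lemma coeff_dart_chain0 (u v : dart U) : qe N v.1 != qe N u.1 ->
  coeff (qe N u.1) (dart_chain N v) = 0.
Proof.
by move=> /negbTE e; rewrite /dart_chain; case: v.2;
  rewrite ?coeffN coeffU e mulr0 ?oppr0.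
Qed.

(** The coefficient at the edge under [u] is a sum of signs, all equal unless some dart of [s]
    crosses that edge the other way. *)
Lemma dart_chain_cancel (u : dart U) (s : seq (dart U)) :
  dart_chain N u + \sum_(v <- s) dart_chain N v = 0 ->
  exists2 v, v \in s & qe N v.1 = qe N u.1 /\ v.2 = ~~ u.2.
Proof.
move=> H; apply: contrapT => no.
have {}no v : v \in s -> qe N v.1 = qe N u.1 -> v.2 = u.2.
  move=> vs vu; apply: contrapT => /eqP; rewrite -addbN addbC => vu2; apply: no.
  by exists v => //; split=> //; move: vu2; case: v.2; case: u.2.
have := congr1 (coeff (qe N u.1)) H; rewrite coeff0 raddfD raddf_sum /=.
rewrite coeff_dart_chain// => E.
have : if u.2 then 0 <= \sum_(v <- s) coeff (qe N u.1) (dart_chain N v)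
  else \sum_(v <- s) coeff (qe N u.1) (dart_chain N v) <= 0.
  case: ifP => u2; rewrite big_seq; [apply: sumr_ge0|apply: sumr_le0] => v vs;
  by have [e|/coeff_dart_chain0->//] := eqVneq (qe N v.1) (qe N u.1);
    rewrite coeff_dart_chain// (no v vs e) u2.
move: E; set S := \sum_(v <- s) _; case: u.2 => E S0.
  by have : 0 < 1 + S := ltr_pwDl ltr01 S0; rewrite E ltxx.
by have : -1 + S < 0 := ltr_wnDr S0 (ltrN10 _); rewrite E ltxx.
Qed.

(* If every closed path of the cover is null as a chain, the 1-skeleton is a
   tree: the lift of a shortest closed path must backtrack over its first
   edge, which splits it into two shorter closed paths. *)
Lemma closed_lift_trivial :
  (forall c p g, N g -> walk (cend c) p -> ext c p = act g c ->
    lift_chain N c p = 0) ->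
  forall c p g, N g -> walk (cend c) p -> ext c p = act g c -> g = 1%g.
Proof.
move=> null c p; have [n] := ubnP (size p); elim: n c p => // n IH c p sp g Ng w cp.
have := null _ _ _ Ng w cp; case: p sp w cp => [_ _|d q].
  by rewrite ext_nil => /esym/act_free.
rewrite /= ltnS => sq w cp; have /= /andP[/eqP dc wq] := w.
have [u uE [_ su tu]] := udartP dc.
rewrite lift_chain_cons// (lift_chain1 _ uE) => /dart_chain_cancel[v vq [vu v2]].
have wq' : walk (cend (ext c [:: d])) q by rewrite cend_step.
have [p2 [d' [p3 [qE d'2 vE]]]] := ulift_path_mem wq' vq.
have [v' + [_ sv tv]] := udartP d'2; rewrite vE => -[vv']; subst v'.
(* [v] runs backwards over the [g']-translate of the edge of [u], so [p2] leads from the end of [u]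
   to the [g']-translate of that end. Induction gives g' = 1; then [p3] leads from [c] to
   [act g c]. *)
have [g' Ng' uv] : exists2 g', N g' & v.1 = uact g' u.1.
  have [g' Ng' ->] := (orbit_eqP sN u.1 v.1 (@uact1 _ _ _ _) (@uactM _ _ _ _)).1 (esym vu).
  by exists g'.
have [sv' tv'] : dsrc v = act g' (dtgt u) /\ dtgt v = act g' (dsrc u).
  rewrite /dsrc /dtgt v2 uv; case: u.2 => /=; rewrite /= ?usrc_act ?utgt_act//.
have szq : (size q = size p2 + (size p3).+1)%N by rewrite qE; exact: size_cat.
move: wq'; rewrite qE walk_cat /= => /and3P[w2 _ w3].
have g'1 : g' = 1%g.
  apply: (IH (ext c [:: d]) p2) => //; last by rewrite -sv sv' tu.
  by move: sq; rewrite szq; lia.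
have tc : ext (ext (ext c [:: d]) p2) [:: d'] = c by rewrite -tv tv' g'1 actg1 su.
apply: (IH c p3) => //.
- by move: sq; rewrite szq; lia.
- by move: w3; rewrite -(cend_step d'2) tc.
- have wp2 : walk (cend (ext c [:: d])) (p2 ++ d' :: p3) by rewrite -qE cend_step.
  rewrite -cp (ext_cons w) qE ext_cat//.
  rewrite (@ext_cons _ _ (ext (ext c [:: d]) p2) d' p3) ?tc//.
  by move: wp2; rewrite walk_cat (cend_ext w2) => /andP[].
Qed.

End Degenerate.

(** * Short 2-cycles from short loops *)

(** [F] is in effect a function on N / D, which right multiplication by [g] permutes. *)
Lemma coset_sum_shift (G : groupType) (V : zmodType) (N D : set G) (F : G -> V) g :
  subgroup N -> normal_subgroup D -> D `<=` N ->
  finite_set (lcosets N D) -> (forall d h, D d -> F (d * h)%g = F h) -> N g ->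
  \sum_(B <- fset_set (lcosets N D)) F (xget 1%g B * g)%g =
  \sum_(B <- fset_set (lcosets N D)) F (xget 1%g B).
Proof.
move=> sN nD DN fD FD Ng; set Q := fset_set _.
have QP B : B \in Q -> exists2 h, N h & B = lcoset h D.
  by rewrite in_fset_set// inE => -[h Nh <-]; exists h.
have Qin h : N h -> lcoset h D \in Q.
  by move=> Nh; rewrite in_fset_set// inE; exists h.
have FE h k : lcoset h D = lcoset k D -> F h = F k.
  move=> /(lcoset_eq _ _ nD.1) Dhk; rewrite -(FD (h * (h^-1 * k) * h^-1)%g).
    by rewrite !mulgA mulgVK mulgV mul1g.
  exact: normal_conj.
have repK h : lcoset (xget 1%g (lcoset h D)) D = lcoset h D.
  have : lcoset h D (xget 1%g (lcoset h D)).
    by apply: (xgetPex 1%g); exists h; exists 1%g; rewrite ?mulg1//; exact: (subgroup1 nD.1).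
  by move=> [k Dk <-]; apply/esym/(lcoset_eq _ _ nD.1); rewrite mulKg.
transitivity (\sum_(B <- Q) F (xget 1%g (rtrans g B))).
  apply: eq_big_seq => B /QP[h Nh ->]; apply: FE.
  by rewrite rtrans_lcoset// repK -!(rtrans_lcoset _ _ nD) repK.
rewrite -(big_map (rtrans g) xpredT (fun B => F (xget 1%g B))); apply/perm_big/uniq_perm.
- rewrite map_inj_in_uniq ?fset_uniq// => _ _ /QP[h Nh ->] /QP[k Nk ->].
  move=> /(congr1 (rtrans g^-1)).
  by rewrite !rtrans_lcoset// !mulgK.
- exact: fset_uniq.
- move=> B; apply/mapP/idP => [[_ /QP[h Nh ->] ->]|/QP[h Nh ->]].
    by rewrite rtrans_lcoset//; apply: Qin; exact: (subgroupM sN).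
  exists (lcoset (h * g^-1)%g D); last by rewrite rtrans_lcoset// mulgVK.
  by apply: Qin; apply: (subgroupM sN) => //; exact: (subgroupV sN).
Qed.

Section Key.
Variables (R : realType) (X : complex2) (x0 : vert X) (N : set (pi1 x0)).
Local Notation pclass := (pclass x0).
Local Notation U := (universal_cover x0).
Local Notation c0 := (pi1_one x0 : pclass).
Local Notation D := (derived N).
Hypotheses (nN : normal_subgroup N).
Let sN : subgroup N := nN.1.
Let nD : normal_subgroup D := derived_normal nN.
Let DN : D `<=` N := derived_sub sN.
Hypothesis fD : finite_set (lcosets N D).
Variable l : nat.
Hypothesis short : forall c : pclass, exists (u : epath x0) d,
  [/\ D d, pi_ u = act d c & (size (val u) <= l)%N].

(* Chosen from the D-orbit of c, not from c itself, so as to be D-invariant. *)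
Definition short_path (c : pclass) : epath x0 :=
  xget (nilpath x0) [set u | orbit D (@act X x0) c (pi_ u) /\ (size (val u) <= l)%N].

Lemma short_pathP c :
  (exists2 d, D d & pi_ (short_path c) = act d c) /\
  (size (val (short_path c)) <= l)%N.
Proof.
have [u [d [Dd ud ul]]] := short c.
have [[d' Dd' <-] sz] : [set u | orbit D (@act X x0) c (pi_ u) /\ (size (val u) <= l)%N]
    (short_path c).
  by apply: (xgetPex (nilpath x0)); exists u; split=> //; exists d.
by split=> //; exists d'.
Qed.

Lemma short_path_act d c : D d -> short_path (act d c) = short_path c.
Proof.
move=> Dd; rewrite /short_path; congr (xget _ _).
have : to_orbit D (@act X x0) c = to_orbit D (@act X x0) (act d c).
  apply/(orbit_eqP nD.1); [exact: actg1|exact: actgM|by exists d].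
by move=> /(congr1 val) /= ->.
Qed.

Definition short_chain c := lift_chain N c0 (val (short_path c)).

Lemma walk_epath (u : epath x0) : walk (cend c0) (val u).
Proof. by rewrite cend_c0; exact: valP. Qed.

Definition edge_loop (e : uedge x0) : chain (edge (cover N)) :=
  short_chain (usrc e) + << qe N e >> - short_chain (utgt e).

Lemma edge_loop_act d e : D d -> edge_loop (uact d e) = edge_loop e.
Proof.
move=> Dd; rewrite /edge_loop /short_chain usrc_act utgt_act !short_path_act//.
by rewrite qe_act//; exact: DN.
Qed.

Lemma udart_edge (e : uedge x0) : udart (usrc e) ((val e).2, true) = Some (e, true).
Proof.
rewrite /udart /=; have -> : (usrc e, (val e).2) = val e by rewrite /usrc; case: (val e).
by rewrite valK.
Qed.

Lemma chain_norm_edge_loop e : (chain_norm (edge_loop e) <= 2 * l + 1)%N.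
Proof.
have H c : (chain_norm (short_chain c) <= l)%N.
  exact: leq_trans (chain_norm_lift N (walk_epath _)) (short_pathP c).2.
apply: leq_trans (chain_normD _ _) _; rewrite chain_normN.
apply: leq_trans (leq_add (leq_trans (chain_normD _ _) (leq_add (H _) (leqnn _))) (H _)) _.
by rewrite chain_normU; lia.
Qed.

(** The short paths [u] and [u'] end at the translates by [d] and [d'] of the ends of [e]. Going out
    along [u], across the edge and back along [u'] therefore closes up with class d d'^-1, an
    element of D. *)
Lemma edge_loop_boundary e : @boundaries1 (cover N) (edge_loop e).
Proof.
set k : dart X := ((val e).2, true); set c := usrc e.
have dk : dsrc k = cend c by rewrite /c /usrc (eqP (valP e)).
have cE : utgt e = ext c [:: k] by [].
have [[d Dd ud] _] := short_pathP c; set u := short_path c in ud.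
have [[d' Dd' ud'] _] := short_pathP (utgt e); set u' := short_path (utgt e) in ud'.
have dk' : dsrc k = cend (act d c) by rewrite cend_act.
have wu' := walk_epath u'.
have wk : walk (cend (ext c0 (val u))) (k :: pinv (val u')).
  rewrite ext_c0 ud /= dk' eqxx /=.
  have [+ _] := walk_pinv wu'; congr is_true.
  rewrite -(cend_ext wu') ext_c0 ud' cend_act cE.
  by rewrite -(cend_step dk).
have wp : walk x0 (val u ++ k :: pinv (val u')).
  rewrite walk_cat; apply/andP; split; first exact: valP.
  by move: wk; rewrite cend_ext ?walk_epath// cend_c0.
pose p : epath x0 := exist (fun p => walk x0 p) _ wp.
have E1 : act (d * d'^-1)%g (ext c0 (val u')) = ext (act d c) [:: k].
  by rewrite ext_c0 ud' -actgM mulgVK cE act_ext// walk_step.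
have pE : pi_ p = (d * d'^-1)%g.
  rewrite -ext_c0 ext_cat ?ext_c0 ?ud; last first.
    by rewrite walk_cat walk_epath/= -(cend_ext (walk_epath u)).
  rewrite ext_cons; last by move: wk; rewrite ext_c0 ud.
  rewrite -E1 -act_ext; last by rewrite cend_ext//; have [] := walk_pinv wu'.
  by rewrite ext_pinv// act_c0.
have DV : D (d * d'^-1)%g by apply: (subgroupM nD.1) => //; exact: (subgroupV nD.1).
have := boundaries1D (lift_chain_loop sN pE) (derived_boundary sN DV).
rewrite subrK lift_chain_cat ?walk_epath// ext_c0 ud lift_chain_cons//.
rewrite -E1 (lift_chain_act sN (DN DV)); last first.
  by rewrite cend_ext//; have [] := walk_pinv wu'.
rewrite lift_chain_pinv// lift_chain_act ?walk_step//; last exact: DN.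
by rewrite (lift_chain1 N (udart_edge e)) addrA.
Qed.

Lemma telescope_loops (c : vert U) (p : seq (dart U)) : walk c p ->
  \sum_(u <- p) (if u.2 then edge_loop u.1 else - edge_loop u.1) =
  short_chain c + \sum_(u <- p) dart_chain N u - short_chain (wend c p).
Proof.
elim: p c => [|u p IH] c /=; first by rewrite !big_nil addr0 subrr.
move=> /andP[/eqP uc wp]; rewrite !big_cons (IH _ wp) -[wend c _]/(wend (dtgt u) p).
rewrite -uc /dsrc /dtgt /dart_chain /edge_loop /=; case: u.2.
  by rewrite !addrA subrK.
rewrite opprB opprD !addrA; congr (_ + _ - _).
by rewrite addrAC subrK.
Qed.

Lemma ulift_path_act g (c : pclass) p : walk (cend c) p ->
  ulift_path (act g c) p =
  [seq (uact g u.1, u.2) : dart U | u <- ulift_path c p].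
Proof.
elim: p c => [//|d p IH] c w; have /= /andP[/eqP dc wp] := w.
rewrite udart_act//; have [u uE _] := udartP dc; rewrite uE /=.
by rewrite -act_ext ?walk_step// IH// cend_step.
Qed.

Lemma ubdry_act g (f : uface x0) :
  ubdry (uact g f) = [seq (uact g u.1, u.2) : dart U | u <- ubdry f].
Proof. exact: ulift_path_act (uface_walk f). Qed.

Lemma xi2_short (n L : nat) (x : R) :
  finite_set [set: face (cover N)] ->
  (forall f : face X, (size (bdry f) <= L)%N) -> 0 <= x -> (0 < n)%N ->
  (n%:R%:E <= x%:E * rho1 (cover N) R)%E ->
  xi2 (cover N) R <= 1 + L%:R * (x * (2 * l + 1)%:R / n%:R).
Proof.
move=> finF Lb x_ge0 n0 nx.
have n0R : 0 < n%:R :> R by rewrite ltr0n.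
(* The filling is a function of the chain, not of the edge, so [A] inherits the D-invariance of
   [edge_loop]. *)
have /choice[fill fillP] : forall z : chain (edge (cover N)), exists A,
    boundaries1 z -> bdry2 A = z /\ (chain_norm A)%:R * n%:R <= x * (chain_norm z)%:R.
  move=> z; have [Bz|nBz] := pselect (boundaries1 z); last by exists 0.
  by have [A Az An] := short_filling x_ge0 nx Bz; exists A.
pose A (e : uedge x0) : chain (face (cover N)) := fill (edge_loop e).
have Abd e : bdry2 (A e) = edge_loop e by have [] := fillP _ (edge_loop_boundary e).
have Anorm e : (chain_norm (A e))%:R <= x * (2 * l + 1)%:R / n%:R.
  rewrite ler_pdivlMr//; have [_ /le_trans] := fillP _ (edge_loop_boundary e); apply.
  by rewrite ler_wpM2l// ler_nat chain_norm_edge_loop.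
pose sA (u : dart U) := if u.2 then A u.1 else - A u.1.
pose W (F : uface x0) := << qf N F >> - \sum_(u <- ubdry F) sA u.
have Wcyc F : cycles2 (W F).
  rewrite /cycles2 /= raddfB raddf_sum /= bdry2U bdry_qf//.
  have -> : \sum_(u <- ubdry F) bdry2 (sA u) =
      \sum_(u <- ubdry F) (if u.2 then edge_loop u.1 else - edge_loop u.1).
    by apply: eq_bigr => u _; rewrite /sA; case: u.2; rewrite ?raddfN /= Abd.
  rewrite (telescope_loops (ubdry_walk F)) ubdry_loop [short_chain _ + _]addrC addrK.
  exact: subrr.
have Wnorm F : (chain_norm (W F))%:R <= 1 + L%:R * (x * (2 * l + 1)%:R / n%:R).
  apply: (@le_trans _ _ (1 + \sum_(u <- ubdry F) (chain_norm (sA u))%:R)).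
    rewrite -natr_sum -[1]/(1%:R) -natrD ler_nat.
    apply: leq_trans (chain_normD _ _) _.
    by rewrite chain_normN chain_normU leq_add2l; exact: chain_norm_sum.
  rewrite lerD2l.
  apply: (@le_trans _ _ (\sum_(u <- ubdry F) (x * (2 * l + 1)%:R / n%:R))).
    apply: ler_sum => u _; rewrite /sA; case: u.2; rewrite ?chain_normN; exact: Anorm.
  rewrite big_const_seq count_predT iter_addr_0 -[leLHS]mulr_natl ler_wpM2r ?divr_ge0 ?mulr_ge0//.
  by rewrite ler_nat /ubdry size_ulift_path ?Lb//; exact: uface_walk.
pose Q := fset_set (lcosets N D).
pose r B : pi1 x0 := xget 1%g B.
pose T := card_ab N.
have T0 : (0 < T)%N.
  rewrite /T /card_ab /gindex cardfs_gt0; apply/fset0Pn; exists (lcoset 1%g D).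
  by rewrite in_fset_set// inE; exists 1%g => //; exact: subgroup1.
pose psi (E : edge (cover N)) : chain (face (cover N)) :=
  \sum_(B <- Q) A (uact (r B) (orbit_repr E)).
(* The value of Psi does not depend on the lift of the edge: another lift is a translate by some [g]
   in [N], and [coset_sum_shift] applies. *)
have psiE e : \sum_(B <- Q) A (uact (r B) e) = psi (qe N e).
  rewrite /psi; set e0 := orbit_repr (qe N e).
  have [g Ng eE] := (orbit_eqP sN e0 e (@uact1 _ _ _ _) (@uactM _ _ _ _)).1
    (orbit_reprK (qe N e)).
  transitivity (\sum_(B <- Q) A (uact (r B * g)%g e0)).
    by apply: eq_bigr => B _; rewrite uactM -eE.
  apply: (coset_sum_shift (F := fun h => A (uact h e0))) => // d h Dd.
  by rewrite uactM /A edge_loop_act.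
have rN B : B \in Q -> N (r B).
  rewrite in_fset_set// inE => -[g Ng <-]; rewrite /r.
  have : lcoset g D (xget 1%g (lcoset g D)).
    by apply: (xgetPex 1%g); exists g; exists 1%g; rewrite ?mulg1//; exact: (subgroup1 nD.1).
  by move=> [k Dk <-]; apply: (subgroupM sN) => //; exact: DN.
have sumW (s : face (cover N)) : \sum_(B <- Q) W (uact (r B) (orbit_repr s)) =
    << s >> *+ T - fglift psi (bdry_face s).
  rewrite /W sumrB; congr (_ - _).
    transitivity (\sum_(B <- Q) (<< s >> : chain (face (cover N)))).
      apply: eq_big_seq => B /rN NB; congr (<< _ >>); rewrite -[RHS]orbit_reprK.
      apply/esym/(orbit_eqP sN); [exact: uact1|exact: uactM|by exists (r B)].
    by rewrite big_const_seq count_predT iter_addr_0.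
  under eq_bigr do rewrite ubdry_act big_map.
  rewrite exchange_big /= /bdry_face /= /qbdry big_map raddf_sum; apply: eq_bigr => u _.
  rewrite /sA /=; case: u.2; rewrite /= ?raddfN /= liftU scale1r -psiE //.
  by rewrite sumrN.
pose FS := fset_set [set: face (cover N)].
pose J : finType := (FS * Q)%type.
apply: (@xi2_le _ _ J (fun j => W (uact (r (val j.2)) (orbit_repr (val j.1)))) T) => //.
  by rewrite addr_ge0// mulr_ge0// divr_ge0// mulr_ge0.
(* Weighting [sumW] by the coefficients of [Z] gives T Z - Psi(d Z), and d Z = 0. *)
move=> Z Zcyc; exists (fun j => coeff (val j.1) Z).
rewrite -(pair_bigA _ (fun s B => W (uact (r (val B)) (orbit_repr (val s))) *~ coeff (val s) Z)) /=.
transitivity (\sum_(s <- FS) (\sum_(B <- Q) W (uact (r B) (orbit_repr s))) *~ coeff s Z).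
  have ZE : Z = \sum_(s <- FS) << s >> *~ coeff s Z.
    by apply: chain_sumE => [|s _]; [exact: fset_uniq|rewrite in_fset_set// inE].
  under eq_bigr do rewrite sumW mulrzBl -raddfMz.
  rewrite sumrB -raddf_sum.
  have -> : \sum_(s <- FS) bdry_face s *~ coeff s Z = bdry2 Z.
    by rewrite [in RHS]ZE raddf_sum; apply: eq_bigr => s _; rewrite raddfMz /= bdry2U.
  rewrite Zcyc raddf0 subr0 [in LHS]ZE -sumrMnl; apply: eq_bigr => s _.
  by rewrite !pmulrn mulrzAC.
rewrite big_seq_fsetE; apply: eq_bigr => s _.
by rewrite mulrz_suml big_seq_fsetE.
Qed.

End Key.

Lemma finite_nat_bound (T : choiceType) (A : set T) (f : T -> nat) :
  finite_set A -> exists K, forall x, A x -> (f x <= K)%N.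
Proof.
move=> fA; exists (\max_(x <- fset_set A) f x) => x Ax.
by apply: (leq_bigmax_seq x) => //; rewrite in_fset_set// inE.
Qed.

(** * Paths in the universal cover and words in the fundamental group *)

Section Paths.
Variables (X : complex2) (x0 : vert X).
Local Notation pclass := (pclass x0).
Local Notation U := (universal_cover x0).
Local Notation c0 := (pi1_one x0 : pclass).
Implicit Types (c : pclass) (g : pi1 x0) (N : set (pi1 x0)).

(** Paths with the same endpoint differ by a loop: [c] followed by the reverse of [c']. *)
Lemma act_transitive c c' : cend c = cend c' -> exists g, c = act g c'.
Proof.
move=> cc; pose v := repr c'.
have wv : walk (cend c0) (val v) by exact: walk_epath.
have vE : ext c0 (val v) = c' by rewrite ext_c0 pi_repr.
have [w1 w2] := walk_pinv wv; rewrite -(cend_ext wv) vE -cc in w1 w2.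
have gP : cend (ext c (pinv (val v))) == x0 by rewrite cend_ext// w2 cend_c0.
exists (Pi1 gP); rewrite -[c'](pi_repr c') act_pi /=.
by have := ext_pinv w1; rewrite pinvK => ->.
Qed.

Lemma word_path (S : seq (pi1 x0)) (K : nat) :
  (forall s, s \in letters S -> (size (val (repr (s : pclass))) <= K)%N) ->
  forall r g, word_ball S r g -> exists u : epath x0,
    pi_ u = g /\ (size (val u) <= K * r)%N.
Proof.
move=> SK r _ [w [wS wr <-]].
suff [u [uE us]] : exists u : epath x0, pi_ u = wprod w /\ (size (val u) <= K * size w)%N.
  by exists u; split=> //; apply: leq_trans us _; rewrite leq_mul2l wr orbT.
elim: w wS {wr} => [|s w IH] wS; first by exists (nilpath x0).
have [|u [uE us]] := IH; first by move=> a aw; apply: wS; rewrite inE aw orbT.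
have wu : walk (cend s) (val u) by rewrite pendg; exact: valP.
exists (pcat (repr (s : pclass)) (val u)); split.
  by rewrite -[pi_ _]/(ext s (val u)) -act_pi uE.
rewrite val_pcat// size_cat /= mulnS leq_add// SK//.
by apply: wS; rewrite inE eqxx.
Qed.

Hypothesis Xconn : connected_complex X.

Lemma vertex_path (y : vert X) : exists c, cend c = y.
Proof.
have [p wp yE] := Xconn x0 y; pose u : epath x0 := exist (fun p => walk x0 p) p wp.
by exists (pi_ u); rewrite cend_pi.
Qed.

Definition vpath (y : vert X) : pclass := projT1 (cid (vertex_path y)).

Lemma cend_vpath y : cend (vpath y) = y.
Proof. exact: projT2 (cid (vertex_path y)). Qed.

Lemma finite_faces N : finite_set [set: face X] ->
  normal_subgroup N -> finite_index N -> finite_set [set: face (cover N)].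
Proof.
move=> fX nN fN; have sN := nN.1.
have fP (B : set (pi1 x0)) (f : face X) :
    cend (act (xget 1%g B) (vpath (base f))) == base f.
  by rewrite cend_act cend_vpath.
pose F B f : face (cover N) := qf N (exist _ (_, f) (fP B f)).
apply: sub_finite_set (finite_image2 F fN fX) => s _.
rewrite -[s]orbit_reprK; set e := orbit_repr s.
have [g gE] : exists g, (val e).1 = act g (vpath (base (val e).2)).
  by apply: act_transitive; rewrite cend_vpath (eqP (valP e)).
exists (lcoset g N); first by exists g.
exists (val e).2 => //; rewrite /F /qf.
have : lcoset g N (xget 1%g (lcoset g N)).
  by apply: (xgetPex 1%g); exists g; exists 1%g; rewrite ?mulg1//; exact: subgroup1.
move=> [k Nk gk]; apply/esym/(orbit_eqP sN); [exact: uact1|exact: uactM|].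
exists (g * k * g^-1)%g; first exact: normal_conj.
by apply: val_inj; rewrite /= gE -gk -actgM mulgVK.
Qed.

(** Write c = g q with q the reference vertex over the same point of X. A short word w in the coset
    of g gives w q, a vertex of the D-orbit of c. *)
Lemma orbit_short_path (S : seq (pi1 x0)) (K K' r : nat) (D : set (pi1 x0)) :
  (forall s, s \in letters S -> (size (val (repr (s : pclass))) <= K)%N) ->
  (forall y, (size (val (repr (vpath y))) <= K')%N) ->
  normal_subgroup D ->
  (forall g, exists2 w, word_ball S r w & lcoset w D = lcoset g D) ->
  forall c, exists (u : epath x0) d,
    [/\ D d, pi_ u = act d c & (size (val u) <= K * r + K')%N].
Proof.
move=> SK VK nD diam c; pose q := vpath (cend c).
have [g cE] : exists g, c = act g q by apply: act_transitive; rewrite cend_vpath.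
have [w wr wg] := diam g; have [u [uw us]] := word_path SK wr.
have wq : walk (cend w) (val (repr q)) by rewrite pendg; exact: valP.
have uq : walk (pend u) (val (repr q)) by rewrite -cend_pi uw.
exists (pcat u (val (repr q))), (w * g^-1)%g; split.
- have := normal_conj g nD ((lcoset_eq _ _ nD.1).1 (esym wg)).
  by rewrite !mulgA mulgV mul1g.
- by rewrite cE -actgM mulgVK -ext_pi uw.
- by rewrite val_pcat// size_cat leq_add//; exact: VK.
Qed.

(* If the boundary map of the cover vanishes, its closed paths are null as
   chains, since some power of each is a boundary. *)
Lemma trivial_of_bdry0 N : subgroup N -> finite_set (lcosets N (derived N)) ->
  (forall f : face (cover N), bdry_face f = 0) -> forall g, N g -> g = 1%g.
Proof.
move=> sN fD b0.
have B0 z : @boundaries1 (cover N) z -> z = 0.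
  move=> [A _ <-]; rewrite -(freeg_sumE A) raddf_sum big1// => f _.
  by rewrite /= /bdry2 liftU -/(bdry_face _) b0 scaler0.
(* With no nonzero boundaries [loop_chain] is additive on [N] and zero on the derived subgroup,
   which contains a positive power of [g]; chain groups have no torsion. *)
have loop0 g : N g -> loop_chain N g = 0.
  move=> Ng; have [j /andP[j0 _] /(derived_boundary sN)/B0] :=
    expg_mem sN (derived_subgroup N) fD Ng.
  have -> : loop_chain N (g ^+ j)%g = loop_chain N g *+ j.
    elim: j {j0} => [|j IH].
      have /B0 := loop_chainM sN 1%g (subgroup1 sN).
      by rewrite mul1g opprD addrA subrr sub0r => /eqP; rewrite oppr_eq0 => /eqP.
    have /B0/eqP := loop_chainM sN (g ^+ j)%g Ng.
    by rewrite subr_eq0 -expgS IH mulrS => /eqP.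
  move=> gj; apply/eqP/freeg_eqP => e; rewrite coeff0.
  have := congr1 (coeff e) gj; rewrite coeff0 coeffMn => /eqP.
  by rewrite mulrn_eq0 eqn0Ngt j0 => /eqP.
move=> g Ng.
have w1 : walk (cend c0) (val (repr (g : pclass))) by exact: walk_epath.
apply: (closed_lift_trivial sN _ Ng w1); last first.
  by rewrite ext_c0 pi_repr act_c0.
(* A path closed in the cover but not based there is conjugated to the base vertex by [u], whose two
   contributions to the chain cancel. *)
move=> c p {}g {}Ng w cp {w1}; pose u := repr c.
have wu := walk_epath u; have uE : ext c0 (val u) = c by rewrite ext_c0 pi_repr.
have [wu1 wu2] := walk_pinv wu; rewrite -(cend_ext wu) uE in wu1 wu2.
have cpc : wend (cend c) p = cend c by rewrite -cend_ext// cp cend_act.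
have wl : walk x0 (val u ++ (p ++ pinv (val u))).
  have e : wend x0 (val u) = cend c by rewrite -uE (cend_ext wu) cend_c0.
  by rewrite !walk_cat e w cpc wu1 /= andbT; exact: (valP u).
pose l : epath x0 := exist (fun p => walk x0 p) _ wl.
have wp : walk (cend c) (p ++ pinv (val u)) by rewrite walk_cat w cpc.
have gu : ext (act g c) (pinv (val u)) = g.
  by rewrite -act_ext// -uE ext_pinv// act_c0.
have lE : pi_ l = g.
  by rewrite -ext_c0 /= ext_cat ?uE ?ext_cat ?cp//; exact: walk_epath l.
have := B0 _ (lift_chain_loop sN lE); rewrite loop0// subr0.
rewrite /= lift_chain_cat// uE lift_chain_cat// cp lift_chain_act//.
by rewrite -[in lift_chain _ c (pinv _)]uE lift_chain_pinv// addrC subrK.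
Qed.

End Paths.

(** * The main estimate *)

Lemma xi2_ge0 (X : complex2) (R : realType) : 0 <= xi2 X R.
Proof.
rewrite /xi2; case: ifP => // _.
set A := (X in inf X); have [->|/set0P A0] := eqVneq A set0; first by rewrite inf0.
by apply: lb_le_inf => // _ [S _ <-]; rewrite ler0n.
Qed.

Lemma limn_einf_ge (R : realType) (u : (\bar R)^nat) (a : \bar R) (m : nat) :
  (forall i, (m <= i)%N -> (a <= u i)%E) -> (a <= limn_einf u)%E.
Proof.
move=> au; rewrite limn_einf_lim; apply: lime_ge; first exact: is_cvg_einfs.
near=> n; apply: le_ereal_inf_tmp => _ [k /= nk <-]; apply: au.
by apply: leq_trans nk; near: n; exact: nbhs_infty_ge.
Unshelve. all: by end_near. Qed.

Lemma half_absorb (R : realFieldType) (x q : R) :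
  x <= 1 + q / 2 -> q <= x -> x <= 2.
Proof. by lra. Qed.

Section IndexBound.
Variables (R : realType) (X : complex2) (x0 : vert X) (C : R).
Hypotheses (Xfin : finite_complex X) (Xconn : connected_complex X).
Hypotheses (Xtau : property_tau (pi1 x0) R) (C0 : 0 < C).

(** The constants do not depend on [N]. The first alternative is the case of a cover all of whose
    2-cells have zero boundary. *)
Lemma index_le_log : exists (a b : R), 0 < a /\
  forall (N : set (pi1 x0)) (n := gindex [set: pi1 x0] N),
    normal_subgroup N -> finite_index N ->
    (n%:R%:E <= (C * xi2 (cover N) R)%:E * rho1 (cover N) R)%E ->
    N `<=` [set 1%g] \/
    [/\ (0 < n)%N, (0 < card_ab N)%N &
      n%:R <= a * (ln n%:R + ln (card_ab N)%:R) + b].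
Proof.
have [Vfin Efin Ffin] := Xfin.
have [S gS [eps eps0 gap]] := Xtau.
pose h := eps / (4 * (size S)%:R + 1).
have h0 : 0 < h by rewrite divr_gt0// ltr_wpDl// mulr_ge0// ler0n.
pose c1 := ln (1 + h).
have c10 : 0 < c1 by apply: ln_gt0; lra.
have [Kg KgP] := finite_nat_bound
  (fun s : pi1 x0 => size (val (repr (s : pclass x0)))) (finite_seq (letters S)).
have [Kv KvP] := finite_nat_bound
  (fun y : vert X => size (val (repr (vpath x0 Xconn y)))) Vfin.
have [L LP] := finite_nat_bound (fun f : face X => size (bdry f)) Ffin.
(* The factor 2 makes the correction to xi_2 at most xi_2 / 2 once n exceeds [y * (2 * l + 1)];
   [L.+1] keeps [y] positive even if X has no 2-cell. *)
pose y : R := 2 * L.+1%:R * C.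
have y0 : 0 < y by rewrite !mulr_gt0.
(* From [y * (2 * l + 1)] with l = 2 Kg r + Kv and r at most (ln n + ln T) / c1 + 1; the extra 1
   makes the first constant positive when [Kg] is 0. *)
exists (y * (4 * Kg%:R / c1) + 1), (y * (4 * Kg%:R + 2 * Kv%:R + 1)).
split; first by rewrite ltr_wpDl// mulr_ge0 ?divr_ge0 ?mulr_ge0// ltW.
move=> N n nN fN Nx; have sN := nN.1.
have n0 : (0 < n)%N by exact: gindex_gt0.
have fD : finite_set (lcosets N (derived N)).
  exact: (finite_abelianization gS nN fN eps0).
have [[F F0]|noF] := pselect (exists F : face (cover N), bdry_face F <> 0); last first.
  left=> g Ng; apply: (trivial_of_bdry0 sN fD) Ng => f.
  by apply: contrapT => f0; apply: noF; exists f.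
right; set T := card_ab N.
have T0 : (0 < T)%N.
  rewrite /T /card_ab /gindex cardfs_gt0; apply/fset0Pn; exists (lcoset 1%g (derived N)).
  by rewrite in_fset_set// inE; exists 1%g => //; exact: subgroup1.
split=> //.
have nD := derived_normal nN.
have [fDG mle] := finite_index_trans sN nD.1 (derived_sub sN) fN fD.
set m := gindex [set: pi1 x0] (derived N) in mle.
have m0 : (0 < m)%N by exact: gindex_gt0.
(* At this radius exponential growth would give more than [m] cosets, so the ball has passed half of
   them. *)
pose r := (Num.truncn (ln m%:R / c1)).+1.
have lnm0 : 0 <= ln m%:R :> R by rewrite ln_ge0// ler1n.
have mr : m%:R < (1 + h) ^+ r.
  rewrite -ltr_ln ?posrE ?ltr0n ?exprn_gt0//; try lra.
  rewrite lnXn; last by lra.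
  by rewrite -[_ *+ r]mulr_natl -ltr_pdivrMr//; exact: truncnS_gt.
have half : (m < 2 * #|` coset_ball S (derived N) r|)%N.
  have [//|] := ball_growth nD fDG (gap _ nD fDG) eps0 r.
  move=> /(lt_le_trans mr); rewrite ltr_nat ltnNge; case/negP.
  exact/fsubset_leq_card/coset_ball_sub.
have short := orbit_short_path KgP (fun y => KvP y I) nD
  (fun g => half_ball_diam nD fDG g half).
set l := (Kg * (r + r) + Kv)%N in short.
set xi := xi2 (cover N) R in Nx.
have xi_ge0 : 0 <= xi by exact: xi2_ge0.
have Cxi : 0 <= C * xi by rewrite mulr_ge0// ltW.
have LP' (f : face X) : (size (bdry f) <= L.+1)%N by apply: leqW; exact: (LP f I).
have := xi2_short nN fD short (finite_faces Xconn Ffin nN fN) LP' Cxi n0 Nx.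
rewrite -/xi => xi_le.
have n_le : n%:R <= C * xi * L.+1%:R.
  have BF : boundaries1 (bdry_face F) by exists << F >> => //; exact: bdry2U.
  have [A AF] := short_filling Cxi Nx BF.
  have A1 : (1 <= chain_norm A)%N.
    rewrite lt0n; apply/negP => /eqP/chain_norm_eq0 A0; apply: F0.
    by rewrite -AF A0 raddf0.
  have FL : (chain_norm (bdry_face F) <= L.+1)%N.
    rewrite -[F]orbit_reprK (bdry_qf sN).
    by apply: leq_trans (chain_norm_lift _ (uface_walk _)) _.
  move=> /le_trans H; apply: (@le_trans _ _ ((chain_norm A)%:R * n%:R)).
    by rewrite ler_peMl ?ler0n// ler1n.
  by apply: H; rewrite ler_wpM2l// ler_nat.
have n0R : 0 < n%:R :> R by rewrite ltr0n.
(* Otherwise xi is at most 1 + xi / 2, hence at most 2, and [n_le] gives n <= y, a contradiction. *)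
have nl : n%:R <= y * (2 * l + 1)%:R.
  rewrite leNgt; apply/negP => H.
  have l1 : 1 <= (2 * l + 1)%:R :> R by rewrite ler1n addn1.
  have e : L.+1%:R * (C * xi * (2 * l + 1)%:R / n%:R) = xi * (y * (2 * l + 1)%:R) / n%:R / 2.
    by rewrite /y; field; rewrite gt_eqF.
  have : xi * (y * (2 * l + 1)%:R) / n%:R <= xi.
    by rewrite ler_pdivrMr// ler_wpM2l// ltW.
  move=> H2; have xi2le : xi <= 2 by apply: half_absorb H2; rewrite -e.
  have : n%:R <= y.
    apply: le_trans n_le _; rewrite /y [leRHS]mulrC mulrA ler_wpM2r//.
    by rewrite ler_wpM2l// ltW.
  move=> ny; have : y <= y * (2 * l + 1)%:R by rewrite ler_peMr// ltW.
  by move=> /(le_trans ny)/(lt_le_trans H); rewrite ltxx.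
apply: le_trans nl _.
have rle : r%:R <= (ln n%:R + ln T%:R) / c1 + 1 :> R.
  have /truncn_itv/andP[trunc_le _] : 0 <= ln m%:R / c1 by rewrite divr_ge0// ltW.
  rewrite /r -natr1 lerD2r; apply: le_trans trunc_le _.
  rewrite ler_pM2r ?invr_gt0// -lnM ?posrE ?ltr0n// -natrM.
  by rewrite ler_ln ?posrE ?ltr0n ?muln_gt0 ?n0// ler_nat.
have Kg0 : 0 <= Kg%:R :> R by rewrite ler0n.
have lns : 0 <= ln n%:R + ln T%:R :> R by rewrite addr_ge0// ln_ge0// ler1n.
have -> : (2 * l + 1)%:R = 4 * Kg%:R * r%:R + 2 * Kv%:R + 1 :> R.
  by rewrite /l; rewrite !(natrD, natrM); ring.
have : 4 * Kg%:R * r%:R <= 4 * Kg%:R * ((ln n%:R + ln T%:R) / c1 + 1) :> R.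
  by rewrite ler_wpM2l// mulr_ge0.
move=> H; apply: (@le_trans _ _ (y * (4 * Kg%:R * ((ln n%:R + ln T%:R) / c1 + 1) + 2 * Kv%:R + 1))).
  by rewrite ler_pM2l// !lerD2r.
rewrite -subr_ge0; set s := ln n%:R + _ in lns *.
have -> : (y * (4 * Kg%:R / c1) + 1) * s + y * (4 * Kg%:R + 2 * Kv%:R + 1) -
  y * (4 * Kg%:R * (s / c1 + 1) + 2 * Kv%:R + 1) = s by field; rewrite gt_eqF.
by [].
Qed.

End IndexBound.

Theorem corollary1 (R : realType) (X : complex2) (x0 : vert X)
    (Xfin : finite_complex X) (Xconn : connected_complex X)
    (Xtau : property_tau (pi1 x0) R)
    (Gam : nat -> set (pi1 x0)) (Gamchain : residual_chain Gam)
    (C : R) (C0 : 0 < C)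
    (H : forall i,
      ((gindex [set: pi1 x0] (Gam i))%:R%:E <=
         (C * xi2 (cover (Gam i)) R)%:E * rho1 (cover (Gam i)) R)%E) :
  (0 < limn_einf (fun i =>
         (ln (card_ab (Gam i))%:R / (gindex [set: pi1 x0] (Gam i))%:R)%:E :
           \bar R))%E.
Proof.
have [a [b [a0 bound]]] := index_le_log Xfin Xconn Xtau C0.
have [nfGam Gdec _ /cvgnyPge Goo] := Gamchain.
have Gmono i j : (i <= j)%N -> Gam j `<=` Gam i.
  move=> /subnK <-; elim: (j - i)%N => [//|k IH].
  exact: subset_trans (Gdec _) IH.
(* Once a member is trivial, so are all later ones, and the index stays constant. *)
have Gbig i : ~ Gam i `<=` [set 1%g].
  move=> Gi; have [k _ kP] := Goo (gindex [set: pi1 x0] [set 1%g]).+1.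
  have := kP (maxn k i) (leq_maxl _ _); suff -> : Gam (maxn k i) = [set 1%g] by rewrite ltnn.
  apply/seteqP; split; first by apply: subset_trans Gi; apply: Gmono; exact: leq_maxr.
  by move=> _ ->; have [[[]]] := nfGam (maxn k i).
(* The bound ln(n t) <= n t with this [t] gives a ln n <= n / 2 - a ln t, so n / 2 <= a ln T + b'.
   For n >= 4 b' there remains n / 4 <= a ln T, whence the lower bound 1 / (4 a). *)
pose t : R := (2 * a)^-1; pose b' := b - a * ln t.
have t0 : 0 < t by rewrite invr_gt0 mulr_gt0.
have [k _ kP] := Goo (Num.truncn (4 * b')).+1.
apply: (@lt_le_trans _ _ ((4 * a)^-1)%:E).
  by rewrite lte_fin invr_gt0 mulr_gt0.
apply: (@limn_einf_ge _ _ _ k) => i ki; rewrite lee_fin.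
have [nG fG] := nfGam i; have [/Gbig//|[n0 T0]] := bound _ nG fG (H i).
set n := gindex _ _ in n0 *; set T := card_ab _ in T0 *.
have n0R : 0 < n%:R :> R by rewrite ltr0n.
have nb : 4 * b' <= n%:R.
  by apply/ltW/(lt_le_trans (truncnS_gt _)); rewrite ler_nat; exact: kP.
have lnn : ln n%:R <= n%:R * t - ln t :> R.
  have := ltW (ln_sublinear (mulr_gt0 n0R t0)); rewrite lnM ?posrE//; lra.
move=> nT; rewrite ler_pdivlMr// mulrC ler_pdivrMr ?mulr_gt0//.
have at2 : a * (n%:R * t) = n%:R / 2 by rewrite /t; field; rewrite gt_eqF.
have := ler_wpM2l (ltW a0) lnn; rewrite mulrBr at2 => H2.
rewrite /b' in nb; lra.
Qed.
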